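(* Let $E$ be a Courant algebroid over a smooth manifold $X$ whose pairing has signature $(n,n)$, and let $L\subseteq E$ be a Dirac structure. If $L$ has a Dirac complement, then the obstruction class $N^L\in H^3(\mathfrak{a}_{\mathrm{ab}}(L))$ vanishes: $N^L=0$.
   Context: A Courant algebroid over $X$ is a real vector bundle $E\to X$ with a nondegenerate symmetric bilinear pairing $\langle\cdot,\cdot\rangle$, a vector bundle map $\rho:E\to TX$ (anchor), and a bilinear bracket $[\cdot,\cdot]$ on $\Gamma(E)$ such that: (A1) $[e_1,[e_2,e_3]]=[[e_1,e_2],e_3]+[e_2,[e_1,e_3]]$; (A2) $\rho(e_1)\langle e_2,e_3\rangle=\langle[e_1,e_2],e_3\rangle+\langle e_2,[e_1,e_3]\rangle$; (A3) $[e_1,e_2]+[e_2,e_1]=\rho^*d\langle e_1,e_2\rangle$ (with $E\cong E^*$ via the pairing). A subbundle $L$ is lagrangian if $L=L^\perp$; it is a Dirac structure if moreover $[\Gamma(L),\Gamma(L)]\subseteq\Gamma(L)$. A lagrangian (resp. Dirac) complement of $L$ is a lagrangian subbundle (resp. Dirac structure) $M$ with $L\oplus M=E$; every lagrangian subbundle has a lagrangian complement, and the pairing identifies $L\cong M^*$. Let $L$ be Dirac. The bracket of $\Gamma(L)$ extends to $\Gamma(\bigwedge^\bullet L)$ as the Schouten bracket: $[l_1\wedge\dots\wedge l_p,l'_1\wedge\dots\wedge l'_q]=\sum_{i,j}(-1)^{i+j}[l_i,l'_j]\wedge l_1\wedge\dots\widehat{l_i}\dots\wedge l_p\wedge l'_1\wedge\dots\widehat{l'_j}\dots\wedge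 l'_q$ for $p,q\ge1$, and $[l_1\wedge\dots\wedge l_p,f]=\sum_i(-1)^{p-i}(\rho(l_i)f)\,l_1\wedge\dots\widehat{l_i}\dots\wedge l_p$, $[f,P]=(-1)^{p}[P,f]$, for functions $f$ and $P\in\Gamma(\bigwedge^pL)$. Put $\mathfrak{a}(L)=\Gamma(\bigwedge^\bullet L)[1]$ (degree shifted by one so that the bracket has degree $0$), and $\mathfrak{a}_{\mathrm{ab}}(L)=\mathfrak{a}(L)/[\mathfrak{a}(L),\mathfrak{a}(L)]$, where $[\mathfrak{a}(L),\mathfrak{a}(L)]$ is the space of finite sums of brackets of elements of $\mathfrak{a}(L)$. Write $\underline{\alpha}$ for the class of $\alpha$ in this quotient. For a lagrangian complement $M$ of $L$, $d_M$ is the degree $+1$ graded derivation of the wedge product on $\Gamma(\bigwedge^\bullet L)\cong\Gamma(\bigwedge^\bullet M^* )$ with $(d_Mf)(m)=\rho(m)f$ and $(d_Ml)(m_1,m_2)=\rho(m_1)\langle l,m_2\rangle-\rho(m_2)\langle l,m_1\rangle-\langle l,[m_1,m_2]\rangle$; and $N_M\in\Gamma(\bigwedge^3M^* )\cong\Gamma(\bigwedge^3L)$ is the Nijenhuis tensor $N_M(m_1,m_2,m_3)=\langle[m_1,m_2],m_3\rangle$. The operator $d_M$ descends to a differential $d$ on $\mathfrak{a}_{\mathrm{ab}}(L)$ that does not depend on $M$; $H^k(\mathfrak{a}_{\mathrm{ab}}(L))$ denotes its cohomology, with $k$ counting exterior degree. The class $\underline{N_M}$ is $d$-closed and its cohomology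 class does not depend on $M$. The obstruction class of $L$ is $N^L=[\underline{N_M}]\in H^3(\mathfrak{a}_{\mathrm{ab}}(L))$, for any lagrangian complement $M$. *)

(* Defs.v *)
From HB Require Import structures.
From mathcomp Require Import all_boot all_order all_algebra.
From mathcomp Require Import all_classical all_reals all_analysis.

Set Implicit Arguments.
Unset Strict Implicit.
Unset Printing Implicit Defensive.

Import GRing.Theory Num.Theory.
Import numFieldNormedType.Exports.

Local Open Scope classical_set_scope.
Local Open Scope ring_scope.

Section SmoothManifold.
Variable R : realType.

Fixpoint Ck (m k : nat) (U : set 'rV[R]_m) (f : 'rV[R]_m -> R) : Prop :=
  match k with
  | 0%N => forall y, U y -> {for y, continuous f}
  | k'.+1 => (forall y, U y -> forall v, derivable f y v) /\
             (forall v, Ck k' U ('D_v f))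
  end.

Definition Cinfty (m : nat) (U : set 'rV[R]_m) (f : 'rV[R]_m -> R) : Prop :=
  forall k, Ck k U f.

(* The values of chart_map outside chart_dom, and of chart_inv outside the
   image of chart_dom, are irrelevant. *)
Record chart (X : topologicalType) (m : nat) := Chart {
  chart_dom : set X;
  chart_map : X -> 'rV[R]_m;
  chart_inv : 'rV[R]_m -> X;
  chart_dom_open : open chart_dom;
  chart_im_open : open (chart_map @` chart_dom);
  chart_mapK : forall x, chart_dom x -> chart_inv (chart_map x) = x;
  chart_map_continuous :
    forall x, chart_dom x -> {for x, continuous chart_map};
  chart_inv_continuous :
    forall y, (chart_map @` chart_dom) y -> {for y, continuous chart_inv} }.

Record smooth_manifold (m : nat) := SmoothManifold {
  carrier :> topologicalType;
  carrier_hausdorff : hausdorff_space carrier;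
  carrier_second_countable : @second_countable carrier;
  atlas : set (chart carrier m);
  atlas_cover : forall x : carrier, exists2 c, atlas c & chart_dom c x;
  atlas_compatible : forall c c' i, atlas c -> atlas c' ->
    Cinfty (chart_map c @` (chart_dom c `&` chart_dom c'))
           (fun y => chart_map c' (chart_inv c y) ord0 i) }.

Variables (m : nat) (X : smooth_manifold m).

Definition smooth_on (W : set X) (f : X -> R) : Prop :=
  forall c, atlas c ->
    Cinfty (chart_map c @` (chart_dom c `&` W)) (f \o chart_inv c).

Definition smooth (f : X -> R) : Prop := smooth_on setT f.

(* Tangent vectors at x are the derivations at x of the algebra of smooth
   functions; the value of D on non-smooth functions is irrelevant. *)
Definition tangent_vector (x : X) (D : (X -> R) -> R) : Prop :=
  (forall (a : R) f g, smooth f -> smooth g ->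
     D (fun y => a * f y + g y) = a * D f + D g) /\
  (forall f g, smooth f -> smooth g ->
     D (fun y => f y * g y) = D f * g x + f x * D g).

(* A smooth vector bundle of rank r: its fibres together with a family of local
   frames over a cover of X, related by smooth transition matrices. *)
Record vector_bundle (r : nat) := VectorBundle {
  fibre :> X -> vectType R;
  frames : set (set X * ('I_r -> forall x, fibre x));
  frames_open : forall F, frames F -> open F.1;
  frames_cover : forall x, exists2 F, frames F & F.1 x;
  frames_basis : forall F x, frames F -> F.1 x ->
    basis_of fullv [tuple F.2 i x | i < r];
  frames_compatible : forall F F' j, frames F -> frames F' ->
    exists2 g : 'I_r -> X -> R,
      forall i, smooth_on (F.1 `&` F'.1) (g i) &
      forall x, F.1 x -> F'.1 x -> F'.2 j x = \sum_i g i x *: F.2 i x }.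

Variables (r : nat) (E : vector_bundle r).

Definition sec := forall x, E x.

Definition smooth_sec_on (W : set X) (s : sec) : Prop :=
  forall F, frames F -> exists2 g : 'I_r -> X -> R,
    forall i, smooth_on (F.1 `&` W) (g i) &
    forall x, F.1 x -> W x -> s x = \sum_i g i x *: F.2 i x.

Definition smooth_sec (s : sec) : Prop := smooth_sec_on setT s.

Definition subbundle (L : forall x, {vspace E x}) : Prop :=
  forall x0, exists U k (l : 'I_k -> sec),
    [/\ open U, U x0, forall i, smooth_sec_on U (l i) &
        forall x, U x -> basis_of (L x) [tuple l i x | i < k]].

Definition sec_in (L : forall x, {vspace E x}) (s : sec) : Prop :=
  smooth_sec s /\ forall x, s x \in L x.

End SmoothManifold.

Section Courant.
Variables (R : realType) (m : nat) (X : smooth_manifold R m).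
Variables (r : nat) (E : vector_bundle X r).

(* anchor x v f is the derivative of f along rho(v) in T_xX; the bracket is
   only meaningful on smooth sections. *)
Record courant_algebroid := CourantAlgebroid {
  pairing : forall x, E x -> E x -> R;
  pairingC : forall x (u v : E x), pairing u v = pairing v u;
  pairingP : forall x (a : R) (u v w : E x),
    pairing (a *: u + v) w = a * pairing u w + pairing v w;
  pairing_nondegenerate : forall x (u : E x),
    (forall v, pairing u v = 0) -> u = 0;
  pairing_smooth : forall e1 e2 : sec E, smooth_sec e1 -> smooth_sec e2 ->
    smooth (fun x => pairing (e1 x) (e2 x));

  anchor : forall x, E x -> (X -> R) -> R;
  anchor_tangent : forall x (v : E x), tangent_vector x (anchor v);
  anchorP : forall x (a : R) (u v : E x) f, smooth f ->
    anchor (a *: u + v) f = a * anchor u f + anchor v f;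
  anchor_smooth : forall (e : sec E) f, smooth_sec e -> smooth f ->
    smooth (fun x => anchor (e x) f);

  bracket : sec E -> sec E -> sec E;
  bracket_smooth : forall e1 e2, smooth_sec e1 -> smooth_sec e2 ->
    smooth_sec (bracket e1 e2);
  bracketPl : forall (a : R) e1 e2 e3,
    smooth_sec e1 -> smooth_sec e2 -> smooth_sec e3 ->
    forall x, bracket (fun y => a *: e1 y + e2 y) e3 x =
              a *: bracket e1 e3 x + bracket e2 e3 x;
  bracketPr : forall (a : R) e1 e2 e3,
    smooth_sec e1 -> smooth_sec e2 -> smooth_sec e3 ->
    forall x, bracket e1 (fun y => a *: e2 y + e3 y) x =
              a *: bracket e1 e2 x + bracket e1 e3 x;

  bracket_jacobi : forall e1 e2 e3,
    smooth_sec e1 -> smooth_sec e2 -> smooth_sec e3 ->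
    forall x, bracket e1 (bracket e2 e3) x =
              bracket (bracket e1 e2) e3 x + bracket e2 (bracket e1 e3) x;
  bracket_pairing : forall e1 e2 e3,
    smooth_sec e1 -> smooth_sec e2 -> smooth_sec e3 ->
    forall x, anchor (e1 x) (fun y => pairing (e2 y) (e3 y)) =
      pairing (bracket e1 e2 x) (e3 x) + pairing (e2 x) (bracket e1 e3 x);
  (* rho^* d f is the section paired with v to give rho(v) f *)
  bracket_symmetrized : forall e1 e2, smooth_sec e1 -> smooth_sec e2 ->
    forall x (v : E x), pairing (bracket e1 e2 x + bracket e2 e1 x) v =
                        anchor v (fun y => pairing (e1 y) (e2 y)) }.

Variable C : courant_algebroid.

Definition has_signature (p q : nat) : Prop :=
  forall x, exists b : (p + q).-tuple (E x),
    basis_of fullv b /\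
    forall i j, pairing C (tnth b i) (tnth b j) =
                if i == j then (if (i < p)%N then 1 else -1) else 0.

Definition lagrangian (L : forall x, {vspace E x}) : Prop :=
  subbundle L /\
  forall x v, v \in L x <-> (forall w, w \in L x -> pairing C v w = 0).

Definition dirac_structure (L : forall x, {vspace E x}) : Prop :=
  lagrangian L /\
  forall l l', sec_in L l -> sec_in L l' ->
    forall x, bracket C l l' x \in L x.

Definition complementary (L M : forall x, {vspace E x}) : Prop :=
  forall x, (L x + M x)%VS = fullv /\ (L x :&: M x)%VS = 0%VS.

(* Alternating forms of mixed degree on V are functions on sequences of vectors,
   the component of degree k being the restriction to sequences of length k.
   The exterior product is defined by recursion, through
     i_e (a /\ b) = i_e a /\ b + (-1)^|a| a /\ i_e b;
   it is the sum over shuffles without numerical factors, so that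
   (l1 /\ ... /\ lp) (e1, ..., ep) = det (l_i (e_j)) for 1-forms l_i. *)
Fixpoint wedge_prod (V : Type) (a b : seq V -> R) (s : seq V) : R :=
  if s is e :: s' then
    wedge_prod (fun t => a (e :: t)) b s' +
    wedge_prod (fun t => (-1) ^+ size t * a t) (fun t => b (e :: t)) s'
  else a [::] * b [::].

Definition covector x (v : E x) (s : seq (E x)) : R :=
  if s is [:: e] then pairing C v e else 0.

Definition unit_form (V : Type) (s : seq V) : R :=
  if s is [::] then 1 else 0.

(* v1 /\ ... /\ vp, as an alternating form on E_x by means of the pairing *)
Definition wedge_seq x (vs : seq (E x)) : seq (E x) -> R :=
  foldr (fun v w => wedge_prod (covector v) w) (@unit_form (E x)) vs.

(* Fields of alternating forms of mixed degree on E; this type is an R-module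
   for the pointwise operations. *)
Definition form_field := {x : X & seq (E x)} -> R.

Definition mkfield (w : forall x, seq (E x) -> R) : form_field :=
  fun p => w (projT1 p) (projT2 p).

Definition at_pt (w : form_field) x (s : seq (E x)) : R := w (existT _ x s).

Definition fwedge (a b : form_field) : form_field :=
  mkfield (fun x => wedge_prod (at_pt a (x:=x)) (at_pt b (x:=x))).

Definition fn (f : X -> R) : form_field :=
  mkfield (fun x s => f x * unit_form s).

Definition wedge_sec (ls : seq (sec E)) : form_field :=
  mkfield (fun x => wedge_seq [seq l x | l <- ls]).

Section DiracStructure.
Variable L : forall x, {vspace E x}.

(* /\ L_x, the span of the products of elements of L_x inside the forms on E_x:
   as the pairing is nondegenerate, /\ L_x embeds there.  Its elements vanish
   as soon as one argument lies in L_x, so that evaluating them on a lagrangian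
   complement M is the identification /\ L = /\ M^*. *)
Definition multivector x (w : seq (E x) -> R) : Prop :=
  exists k (c : 'I_k -> R) (ls : 'I_k -> seq (E x)),
    (forall i, all (fun v => v \in L x) (ls i)) /\
    (forall s, w s = \sum_i c i * wedge_seq (ls i) s).

(* Gamma (/\ L), with its grading by exterior degree *)
Definition gam (w : form_field) : Prop :=
  (forall x, multivector (at_pt w (x:=x))) /\
  (forall k (e : 'I_k -> sec E), (forall i, smooth_sec (e i)) ->
     smooth (fun x => at_pt w [seq e i x | i <- enum 'I_k])).

Definition gamk (k : nat) (w : form_field) : Prop :=
  gam w /\ forall x (s : seq (E x)), size s <> k -> at_pt w s = 0.

Definition agree_on (U : set X) (a b : form_field) : Prop :=
  forall x (s : seq (E x)), U x -> at_pt a s = at_pt b s.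

(* Indices start at 0 here, which does not change the parity of i + j and turns
   p - i into p - i.+1.  Sections of /\ L need only locally be sums of products
   of global sections, whence the locality clauses. *)
Record is_schouten (br : form_field -> form_field -> form_field) : Prop := IsSchouten {
  schouten_gam : forall a b, gam a -> gam b -> gam (br a b);
  schouten_linl : forall (c : R) a a' b, gam a -> gam a' -> gam b ->
    br (c *: a + a') b = c *: br a b + br a' b;
  schouten_linr : forall (c : R) a b b', gam a -> gam b -> gam b' ->
    br a (c *: b + b') = c *: br a b + br a b';
  schouten_locl : forall U a a' b, open U -> gam a -> gam a' -> gam b ->
    agree_on U a a' -> agree_on U (br a b) (br a' b);
  schouten_locr : forall U a b b', open U -> gam a -> gam b -> gam b' ->
    agree_on U b b' -> agree_on U (br a b) (br a b');
  schouten_wedge : forall p q (l : 'I_p -> sec E) (l' : 'I_q -> sec E),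
    (0 < p)%N -> (0 < q)%N ->
    (forall i, sec_in L (l i)) -> (forall j, sec_in L (l' j)) ->
    br (wedge_sec [seq l i | i <- enum 'I_p])
       (wedge_sec [seq l' j | j <- enum 'I_q]) =
    \sum_(i < p) \sum_(j < q) (-1) ^+ (i + j) *:
      wedge_sec (bracket C (l i) (l' j) ::
        [seq l k | k <- enum 'I_p & k != i] ++
        [seq l' k | k <- enum 'I_q & k != j]);
  schouten_wedge_fn : forall p (l : 'I_p -> sec E) f,
    (0 < p)%N -> (forall i, sec_in L (l i)) -> smooth f ->
    br (wedge_sec [seq l i | i <- enum 'I_p]) (fn f) =
    \sum_(i < p) (-1) ^+ (p - i.+1) *:
      fwedge (fn (fun x => anchor C (l i x) f))
             (wedge_sec [seq l k | k <- enum 'I_p & k != i]);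
  schouten_fn : forall p f P, smooth f -> gamk p P ->
    br (fn f) P = (-1) ^+ p *: br P (fn f);
  schouten_fn_fn : forall f g, smooth f -> smooth g ->
    br (fn f) (fn g) = 0 }.

Section Complement.
Variable M : forall x, {vspace E x}.

Record is_dM (d : form_field -> form_field) : Prop := IsDM {
  dM_degree : forall k a, gamk k a -> gamk k.+1 (d a);
  dM_linear : forall (c : R) a b, gam a -> gam b ->
    d (c *: a + b) = c *: d a + d b;
  dM_derivation : forall k a b, gamk k a -> gam b ->
    d (fwedge a b) = fwedge (d a) b + (-1) ^+ k *: fwedge a (d b);
  dM_fn : forall f mu, smooth f -> sec_in M mu ->
    forall x, at_pt (d (fn f)) [:: mu x] = anchor C (mu x) f;
  dM_sec : forall l m1 m2, sec_in L l -> sec_in M m1 -> sec_in M m2 ->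
    forall x, at_pt (d (wedge_sec [:: l])) [:: m1 x; m2 x] =
      anchor C (m1 x) (fun y => pairing C (l y) (m2 y)) -
      anchor C (m2 x) (fun y => pairing C (l y) (m1 y)) -
      pairing C (l x) (bracket C m1 m2 x) }.

Definition is_nijenhuis (N : form_field) : Prop :=
  gamk 3 N /\
  forall m1 m2 m3, sec_in M m1 -> sec_in M m2 -> sec_in M m3 ->
    forall x, at_pt N [:: m1 x; m2 x; m3 x] =
              pairing C (bracket C m1 m2 x) (m3 x).

End Complement.

Section Abelianization.
Variables (br : form_field -> form_field -> form_field) (d : form_field -> form_field).

(* [a(L), a(L)] *)
Definition in_commutator (w : form_field) : Prop :=
  exists k (a b : 'I_k -> form_field),
    (forall i, gam (a i) /\ gam (b i)) /\ w = \sum_i br (a i) (b i).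

(* equality of the classes of a and b in a_ab(L) *)
Definition eq_ab (a b : form_field) : Prop := in_commutator (a - b).

(* The class in H^(k+1)(a_ab(L)) of the class of w in a_ab(L), given as the set
   of all its representatives in Gamma (/\^(k+1) L). *)
Definition coh_class (k : nat) (w : form_field) : set form_field :=
  [set w' | [/\ gamk k.+1 w', eq_ab (d w') 0 &
                exists2 b, gamk k b & eq_ab w' (w + d b)]].

End Abelianization.

End DiracStructure.
End Courant.

(* Main.v *)
Require Import Defs.
From mathcomp Require Import all_boot all_order all_algebra.
From mathcomp Require Import all_classical all_reals all_analysis.
From mathcomp Require Import ring lra.

(** Let M0 be a Dirac complement of L. It is the graph of a skew map M -> L, that
    is, of a bivector eps in Gamma(/\^2 L), and its Nijenhuis tensor is
    N_M + d_M eps + 1/2 [eps, eps]; there is no cubic term since L is Dirac. As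
    M0 is Dirac this vanishes, so that N_M = d_M (- eps) modulo the single
    commutator - 1/2 [eps, eps].

    The Schouten bracket and d_M are only known on products of global sections of
    L. Near a given point, bump functions provide global sections l_j of L, p_j of
    M and e_j of L such that (l, p) and (l, p + e) are dual frames of (L, M) and
    (L, M0). There eps = 1/2 sum_j l_j /\ e_j, and the identity above, evaluated
    on the p_j, follows from axioms (A2) and (A3) alone. *)

Set Implicit Arguments.
Unset Strict Implicit.
Unset Printing Implicit Defensive.

Import Order.TTheory GRing.Theory Num.Theory.
Import numFieldNormedType.Exports.

Local Open Scope classical_set_scope.
Local Open Scope ring_scope.

(** * Smooth functions and bump functions *)

(** A global section of /\^2 L need not come as a sum of products of global sections, so eps is
    defined pointwise by the projections along L, eps(u, v) = <pi_M0 u, pi_M v>; frames serve only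
    to prove it smooth and to compute with it. Evaluation on the p_j suffices because elements of
    Gamma(/\ L) vanish as soon as one argument lies in L.

    The obstacle in a frame is that the bracket is not linear over functions: in sum_j <e_j, p_b>
    [l_j, e_c] the coefficients cannot be moved inside. Since <l_j, p_a> is locally constant,
    skewness on L and (A2) give <[l_j, e_c], p_a> = <l_j, [e_c, p_a]>, where l_j stands outside the
    bracket and the sum over j collapses to -e_b. A second use of (A2) restores a bracket of e_b and
    e_c and produces the anchor terms.

    The constants balance as follows: the double sum over the frame is 8 times the quadratic part of
    the Nijenhuis tensor of M0, and 8 cancels against 1/4, from the two factors 1/2 in eps, and the
    1/2 before [eps, eps]. *)

Section FlatExponential.
Variable R : realType.

Definition expflat (n : nat) (t : R) : R :=
  if 0 < t then t ^- n * expR (- t^-1) else 0.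

Lemma expflat_ge0 n t : 0 <= expflat n t.
Proof.
rewrite /expflat; case: ifP => // t0.
by rewrite mulr_ge0 ?expR_ge0 // invr_ge0 exprn_ge0 // ltW.
Qed.

Lemma expflat_gt0 n t : 0 < t -> 0 < expflat n t.
Proof. by move=> t0; rewrite /expflat t0 mulr_gt0 ?expR_gt0// invr_gt0 exprn_gt0. Qed.

Lemma expflat_npos n t : t <= 0 -> expflat n t = 0.
Proof. by move=> t0; rewrite /expflat ltNge t0. Qed.

(** With u = 1/t and N = n + 1, e^u = (e^(u/N))^N >= (u/N)^N, because e^y >= 1 + y. The bound is
    linear in t because it has to control a difference quotient at 0. *)
Lemma expflat_le n t : expflat n t <= n.+1%:R ^+ n.+1 * `|t|.
Proof.
rewrite /expflat; case: ifPn => [t0|_]; last by rewrite mulr_ge0.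
rewrite gtr0_norm//.
have u0 : 0 < t^-1 by rewrite invr_gt0.
have n0 : 0 < n.+1%:R :> R by rewrite ltr0n.
have h : (t^-1 / n.+1%:R) ^+ n.+1 <= expR t^-1.
  have -> : expR t^-1 = expR (t^-1 / n.+1%:R) ^+ n.+1.
    by rewrite -expRM_natl mulrC divfK ?gt_eqF.
  apply: lerXn2r; rewrite ?nnegrE ?expR_ge0 ?divr_ge0 ?ltW//.
  by apply: lt_le_trans (expR_ge1Dx _); rewrite ltrDr.
rewrite expRN.
have e0 := expR_gt0 t^-1.
rewrite ler_pdivrMr// -exprVn.
apply: le_trans (ler_wpM2l _ h); last by rewrite mulr_ge0 ?exprn_ge0 ?ltW.
have pn0 : t ^+ n != 0 by rewrite expf_neq0 ?gt_eqF.
rewrite exprMn !exprVn [t ^+ n.+1]exprS.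
suff -> : n.+1%:R ^+ n.+1 * t * ((t * t ^+ n)^-1 / n.+1%:R ^+ n.+1) = (t ^+ n)^-1 by [].
by field; rewrite pn0 (gt_eqF t0) expf_neq0 ?gt_eqF.
Qed.

(** The powers t^-n are carried along so that the family is closed under differentiation up to
    linear combinations; smoothness of e^(-1/t) then follows by induction on the order. Only t = 0
    needs an estimate. *)
Lemma is_derive_expflat n (t : R) :
  is_derive t (1 : R) (expflat n) (expflat n.+2 t - n%:R * expflat n.+1 t).
Proof.
have [t0|t0|t0] := ltgtP 0 t.
- have near_t : \near t, t ^- n * expR (- t^-1) = expflat n t.
    near=> s; rewrite /expflat ifT//; near: s; exact: lt_nbhsr.
  apply: near_eq_is_derive near_t _.
  have tn0 : t != 0 by rewrite gt_eqF.
  have -> : (fun s : R => s ^- n * expR (- s^-1)) =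
    (fun s : R => ((id ^+ n) s)^-1) * (expR \o (fun s => - s^-1)).
    by apply/funext => s /=; rewrite exprfctE.
  have tnn : (id ^+ n : R -> R) t != 0 by rewrite exprfctE expf_neq0.
  have h1 : is_derive t 1 (fun s : R => ((id ^+ n) s)^-1)
     (- ((id ^+ n : R -> R) t) ^- 2 *: ((n%:R * t ^+ n.-1) *: 1)).
    exact: is_deriveV.
  have h2 : is_derive t 1 (fun s : R => - s^-1) (- (- t ^- 2 *: 1)).
    by apply: is_deriveN; apply: is_deriveV.
  have h3 : is_derive t 1 (expR \o (fun s : R => - s^-1)) ((- (- t ^- 2 *: 1)) * expR
    (- t^-1)).
    have := @is_derive1_comp R expR (fun s : R => - s^-1) t (expR (- t^-1)) (- (- t ^-
      2 *: 1)) _ h2.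
    by rewrite mulrC; apply.
  apply: is_derive_eq.
  rewrite /expflat t0 !exprfctE /= /GRing.scale/=.
  set E := expR _.
  case: n {tnn h1} => [|n] /=.
    by rewrite !expr0 !expr1 !mul0r; field.
  by rewrite !exprS; field; rewrite tn0 expf_neq0.
- have near_t : \near t, cst 0 t = expflat n t.
    near=> s; rewrite /expflat ifF//; apply/negbTE; rewrite -leNgt ltW//.
    near: s; exact: lt_nbhsl.
  apply: near_eq_is_derive near_t _.
  by rewrite !expflat_npos ?ltW// mulr0 subr0; apply: is_derive_cst.
- rewrite -t0 !expflat_npos// mulr0 subr0.
  have z : (fun h : R => n.+2%:R ^+ n.+2 * `|h|) @ 0^' --> (0 : R).
    have : (fun h : R => n.+2%:R ^+ n.+2 * `|h|) @ 0^' --> n.+2%:R ^+ n.+2 * `|0 : R|.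
      apply: cvgMl_tmp; apply: cvg_norm; apply: cvg_within_filter; exact: cvg_id.
    by rewrite normr0 mulr0.
  have c : (fun h : R => h^-1 *: (expflat n (h *: 1 + 0) - expflat n 0)) @ 0^' --> (0 :
    R).
    apply: (@squeeze_cvgr _ _ _ _ (fun h => - (n.+2%:R ^+ n.+2 * `|h|)) (fun h =>
      n.+2%:R ^+ n.+2 * `|h|)).
    + near=> h.
      rewrite (expflat_npos _ (lexx 0)) subr0 addr0 /GRing.scale /= mulr1.
      rewrite -ler_norml normrM (ger0_norm (expflat_ge0 _ _)).
      have [h0|h0] := ltrP 0 h; last by rewrite expflat_npos// mulr0 mulr_ge0.
      (* Dividing by h raises the index by one, which explains the constant with [n.+2] in the
         squeezing functions. *)
      have -> : `|h^-1| * expflat n h = expflat n.+1 h; last exact: expflat_le.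
      by rewrite /expflat h0 gtr0_norm ?invr_gt0// exprS invfM mulrA.
    + by have := cvgN z; rewrite oppr0; apply.
    + exact: z.
  by apply: DeriveDef; [apply/cvg_ex; exists 0; exact: c|exact: (cvg_lim _ c)].
Unshelve. all: by end_near. Qed.

End FlatExponential.

(** * Closure properties of smooth functions on open sets of R^m *)

Section CinftyCalculus.
Variables (R : realType) (m : nat).
Implicit Types (U W : set 'rV[R]_m) (f g : 'rV[R]_m -> R).

(** Every clause of [Ck] is a condition at single points of U on derivatives taken in the whole
    space, so it can be tested on singletons even though these are not open. *)
Lemma Ck_pointwise k U f : Ck k U f <-> forall y, U y -> Ck k [set y] f.
Proof.
elim: k f => [|k IH] f /=.
  by split=> [h y Uy _ ->|h y Uy]; [exact: h|exact: (h y Uy)].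
split=> [[h1 h2] y Uy|h].
  split=> [_ -> v|v]; first exact: h1.
  exact: ((IH _).1 (h2 v)).
split=> [y Uy v|v]; first exact: (h y Uy).1.
by apply/IH => y Uy; exact: (h y Uy).2.
Qed.

Lemma Ck_eq k U f g : open U -> (forall y, U y -> f y = g y) ->
  Ck k U f -> Ck k U g.
Proof.
move=> oU; elim: k f g => [|k IH] f g fg /=.
  move=> h y Uy; have near_fg : \near y, f y = g y.
    by near=> z; apply: fg; near: z; exact: open_nbhs_nbhs.
  rewrite /prop_for/continuous_at -(fg y Uy).
  exact: cvg_trans (near_eq_cvg near_fg) (h y Uy).
have near_fg y : U y -> \near y, f y = g y.
  by move=> Uy; near=> z; apply: fg; near: z; exact: open_nbhs_nbhs.
move=> [h1 h2]; split=> [y Uy v|v].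
  exact: near_eq_derivable (near_fg y Uy) (h1 y Uy v).
by apply: IH (h2 v) => y Uy; exact: near_eq_derive (near_fg y Uy).
Unshelve. all: by end_near. Qed.

(* Closed under directional derivatives on an open set, whence the closure
   properties of smooth functions all at once. *)
Inductive smooth_expr U : ('rV[R]_m -> R) -> Prop :=
| SmoothGen f : Cinfty U f -> smooth_expr U f
| SmoothCst c : smooth_expr U (fun=> c)
| SmoothAdd f g : smooth_expr U f -> smooth_expr U g ->
    smooth_expr U (fun y => f y + g y)
| SmoothMul f g : smooth_expr U f -> smooth_expr U g ->
    smooth_expr U (fun y => f y * g y)
| SmoothInv f : (forall y, U y -> f y != 0) -> smooth_expr U f ->
    smooth_expr U (fun y => (f y)^-1)
| SmoothFlat n f : smooth_expr U f -> smooth_expr U (fun y => expflat n (f y)).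

Lemma smooth_expr_derivable U f y v :
  smooth_expr U f -> U y -> derivable f y v.
Proof.
move=> ff Uy; elim: ff => {f} [f h|c|f g _ hf _ hg|f g _ hf _ hg|f f0 _ hf|n f _ hf].
- exact: (h 1%N).1.
- exact: derivable_cst.
- exact: derivableD.
- exact: derivableM.
- exact: derivableV (f0 y Uy) hf.
- apply/derivable1P/derivable1_diffP.
  apply: (@differentiable_comp _ _ _ _ (fun h : R => f (h *: v + y)) (expflat n)).
    by apply/derivable1_diffP; apply: (derivable1P _ _ _).1.
  by apply/derivable1_diffP; have [] := is_derive_expflat n (f (0 *: v + y)).
Qed.

Lemma smooth_expr_continuous U f y :
  smooth_expr U f -> U y -> {for y, continuous f}.
Proof.
move=> ff Uy; elim: ff => {f} [f h|c|f g _ hf _ hg|f g _ hf _ hg|f f0 _ hf|n f _ hf].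
- exact: (h 0%N).
- exact: cst_continuous.
- exact: continuousD.
- exact: continuousM.
- exact: continuousV (f0 y Uy) hf.
- apply: (@continuous_comp _ _ _ f (expflat n)) hf _.
  apply: differentiable_continuous; apply/derivable1_diffP.
  by have [] := is_derive_expflat n (f y).
Qed.

Lemma derive_expflat n f y v : derivable f y v ->
  'D_v (fun y => expflat n (f y)) y =
  (expflat n.+2 (f y) - n%:R * expflat n.+1 (f y)) * 'D_v f y.
Proof.
move=> df; pose F := fun h : R => f (h *: v + y).
have dF : derivable F 0 1 by apply: (derivable1P _ _ _).1.
(* A directional derivative is an ordinary derivative along the line through y, which gives access
   to the chain rule in one variable. *)
have E (g : 'rV[R]_m -> R) : 'D_v g y = derive1 (fun h : R => g (h *: v + y)) 0.
  rewrite derive1E /derive; set g1 := fun h => h^-1 *: _; set g2 := fun h => h^-1 *: _.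
  suff -> : g1 = g2 by [].
  by apply/funext => h; rewrite /g1 /g2 /= addr0 scale0r add0r [_%:A]mulr1.
have dG := is_derive_expflat n (F 0).
rewrite !E; have := @derive1_comp _ F (expflat n) 0 dF (@ex_derive _ _ _ _ _ _ _ dG).
rewrite derive1E [X in _ = X * _]derive1E derive_val.
by rewrite /F scale0r add0r => ->.
Qed.

(** The formula for the derivative is claimed on U only, since derivability is known only there; as
    U is open, [Ck_eq] still transfers smoothness along it. *)
Lemma smooth_expr_derive U f v : smooth_expr U f ->
  exists2 g, smooth_expr U g & forall y, U y -> 'D_v f y = g y.
Proof.
elim=> {f} [f h|c|f g sf hf sg hg|f g sf hf sg hg|f f0 sf hf|n f sf hf].
- exists ('D_v f) => //; apply: SmoothGen => k; exact: (h k.+1).2.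
- exists (fun=> 0); first exact: SmoothCst.
  by move=> y Uy; rewrite derive_cst.
- have [f' sf' ff'] := hf.
  have [g' sg' gg'] := hg.
  exists (fun y => f' y + g' y); first exact: SmoothAdd.
  by move=> y Uy; rewrite deriveD ?ff' ?gg'//; exact: smooth_expr_derivable Uy.
- have [f' sf' ff'] := hf.
  have [g' sg' gg'] := hg.
  exists (fun y => f y * g' y + g y * f' y).
    by apply: SmoothAdd; apply: SmoothMul.
  by move=> y Uy; rewrite [LHS]deriveM ?ff' ?gg'//; exact: smooth_expr_derivable Uy.
- have [f' sf' ff'] := hf.
  exists (fun y => (-1) * ((f y)^-1 * (f y)^-1) * f' y).
    apply: SmoothMul => //; apply: SmoothMul; first exact: SmoothCst.
    by apply: SmoothMul; apply: SmoothInv.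
  move=> y Uy; rewrite deriveV ?ff'//; [|exact: f0|exact: smooth_expr_derivable Uy].
  by rewrite mulN1r expr2 invfM.
- have [f' sf' ff'] := hf.
  exists (fun y => (expflat n.+2 (f y) + (- n%:R) * expflat n.+1 (f y)) * f' y).
    apply: SmoothMul => //; apply: SmoothAdd; first exact: SmoothFlat.
    by apply: SmoothMul; [exact: SmoothCst|exact: SmoothFlat].
  move=> y Uy; rewrite derive_expflat ?ff' ?mulNr//.
  exact: smooth_expr_derivable Uy.
Qed.

Lemma smooth_expr_Cinfty U f : open U -> smooth_expr U f -> Cinfty U f.
Proof.
move=> oU + k; elim: k f => [|k IH] f sf /=.
  by move=> y Uy; exact: smooth_expr_continuous Uy.
split=> [y Uy v|v]; first exact: smooth_expr_derivable Uy.
have [g sg fg] := smooth_expr_derive v sf.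
by apply: Ck_eq oU _ (IH _ sg) => y Uy; rewrite fg.
Qed.

End CinftyCalculus.

(** * Smooth functions on the manifold *)

Section SmoothFunctions.
Variables (R : realType) (m : nat) (X : smooth_manifold R m).
Implicit Types (U V W : set X) (f g : X -> R).

(** Smoothness is a condition at each point, so the sets V may be arbitrary: neither open nor
    contained in W. *)
Lemma smooth_on_cover W f :
  (forall x, W x -> exists2 V : set X, V x & smooth_on V f) -> smooth_on W f.
Proof.
move=> h c ac k; apply/Ck_pointwise => _ [x [dx Wx] <-].
have [V Vx sf] := h x Wx.
by apply: ((Ck_pointwise k _ _).1 (sf c ac k)); exists x.
Qed.

Lemma smooth_on_sub U W f : W `<=` U -> smooth_on U f -> smooth_on W f.
Proof. by move=> WU sf; apply: smooth_on_cover => x /WU; exists U. Qed.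

Lemma smooth_smooth_on W f : smooth f -> smooth_on W f.
Proof. exact: smooth_on_sub. Qed.

Lemma chart_image_open (c : chart R X m) U : open U ->
  open (chart_map c @` (chart_dom c `&` U)).
Proof.
move=> oU; rewrite openE => _ [x [dx Ux] <-].
have im_x : (chart_map c @` chart_dom c) (chart_map c x) by exists x.
have h1 : nbhs (chart_map c x) (chart_map c @` chart_dom c).
  by apply: open_nbhs_nbhs; split=> //; exact: chart_im_open.
have h2 : nbhs (chart_map c x) (chart_inv c @^-1` U).
  by apply: (chart_inv_continuous im_x); apply: open_nbhs_nbhs; rewrite chart_mapK.
rewrite /interior; apply: filterS (filterI h1 h2) => _ [[y dy <-]] /=.
by rewrite chart_mapK// => Uy; exists y.
Qed.

Lemma smooth_on_eq W f g : open W -> (forall x, W x -> f x = g x) ->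
  smooth_on W f -> smooth_on W g.
Proof.
move=> oW fg sf c ac k; apply: Ck_eq (chart_image_open oW) _ (sf c ac k).
by move=> _ [x [dx Wx] <-] /=; rewrite chart_mapK// fg.
Qed.

Lemma smooth_on_cst W (a : R) : open W -> smooth_on W (fun=> a).
Proof.
move=> oW c ac; apply: smooth_expr_Cinfty (chart_image_open oW) _.
exact: SmoothCst.
Qed.

Lemma smooth_onD W f g : open W -> smooth_on W f -> smooth_on W g ->
  smooth_on W (fun x => f x + g x).
Proof.
move=> oW sf sg c ac; apply: smooth_expr_Cinfty (chart_image_open oW) _.
by apply: (SmoothAdd (f := f \o _) (g := g \o _)); apply: SmoothGen; [exact: sf|exact:
  sg].
Qed.

Lemma smooth_onM W f g : open W -> smooth_on W f -> smooth_on W g ->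
  smooth_on W (fun x => f x * g x).
Proof.
move=> oW sf sg c ac; apply: smooth_expr_Cinfty (chart_image_open oW) _.
by apply: (SmoothMul (f := f \o _) (g := g \o _)); apply: SmoothGen; [exact: sf|exact:
  sg].
Qed.

Lemma smooth_onV W f : open W -> (forall x, W x -> f x != 0) ->
  smooth_on W f -> smooth_on W (fun x => (f x)^-1).
Proof.
move=> oW f0 sf c ac; apply: smooth_expr_Cinfty (chart_image_open oW) _.
apply: (SmoothInv (f := f \o _)); last by apply: SmoothGen; exact: sf.
by move=> _ [x [dx Wx] <-] /=; rewrite chart_mapK// f0.
Qed.

Lemma smooth_on_expflat n W f : open W -> smooth_on W f ->
  smooth_on W (fun x => expflat n (f x)).
Proof.
move=> oW sf c ac; apply: smooth_expr_Cinfty (chart_image_open oW) _.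
by apply: (@SmoothFlat _ _ _ n (f \o _)); apply: SmoothGen; exact: sf.
Qed.

Lemma smooth_onN W f : open W -> smooth_on W f -> smooth_on W (fun x => - f x).
Proof.
move=> oW sf; have := smooth_onM oW (smooth_on_cst (-1) oW) sf.
by apply: smooth_on_eq => // x _; rewrite mulN1r.
Qed.

Lemma smooth_onB W f g : open W -> smooth_on W f -> smooth_on W g ->
  smooth_on W (fun x => f x - g x).
Proof. by move=> oW sf sg; apply: smooth_onD => //; exact: smooth_onN. Qed.

Lemma smooth_on_sum W (I : Type) (s : seq I) (P : pred I) (F : I -> X -> R) :
  open W -> (forall i, P i -> smooth_on W (F i)) ->
  smooth_on W (fun x => \sum_(i <- s | P i) F i x).
Proof.
move=> oW sF; elim: s => [|i s IH].
  by apply: smooth_on_eq (smooth_on_cst 0 oW) => // x _; rewrite big_nil.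
case: (boolP (P i)) => Pi.
  by apply: smooth_on_eq (smooth_onD oW (sF i Pi) IH) => // x _; rewrite big_cons Pi.
by apply: smooth_on_eq IH => // x _; rewrite big_cons (negbTE Pi).
Qed.

Lemma smooth_on_prod W (I : Type) (s : seq I) (P : pred I) (F : I -> X -> R) :
  open W -> (forall i, P i -> smooth_on W (F i)) ->
  smooth_on W (fun x => \prod_(i <- s | P i) F i x).
Proof.
move=> oW sF; elim: s => [|i s IH].
  by apply: smooth_on_eq (smooth_on_cst 1 oW) => // x _; rewrite big_nil.
case: (boolP (P i)) => Pi.
  by apply: smooth_on_eq (smooth_onM oW (sF i Pi) IH) => // x _; rewrite big_cons Pi.
by apply: smooth_on_eq IH => // x _; rewrite big_cons (negbTE Pi).
Qed.

Lemma smooth_on_chart_coord (c : chart R X m) i : atlas c ->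
  smooth_on (chart_dom c) (fun x => chart_map c x ord0 i).
Proof. by move=> ac c' ac'; exact: atlas_compatible. Qed.

Lemma smooth_on_det W k (A : 'I_k -> 'I_k -> X -> R) : open W ->
  (forall i j, smooth_on W (A i j)) ->
  smooth_on W (fun x => \det (\matrix_(i, j) A i j x)).
Proof.
move=> oW sA; rewrite /determinant; apply: smooth_on_sum => // s _.
apply: smooth_onM => //; first exact: smooth_on_cst.
apply: smooth_on_prod => // i _.
by apply: smooth_on_eq (sA i (perm.fun_of_perm s i)) => // x _; rewrite mxE.
Qed.

(** Cramer's rule: the entries are cofactors divided by a determinant that does not vanish on W. *)
Lemma smooth_on_invmx W k (A : 'I_k -> 'I_k -> X -> R) i j : open W ->
  (forall i j, smooth_on W (A i j)) ->
  (forall x, W x -> \matrix_(i, j) A i j x \in unitmx) ->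
  smooth_on W (fun x => invmx (\matrix_(i, j) A i j x) i j).
Proof.
move=> oW sA uA.
pose B p q x := A (lift j p) (lift i q) x.
have : smooth_on W (fun x => (\det (\matrix_(i, j) A i j x))^-1 *
    ((-1) ^+ (j + i) * \det (\matrix_(p, q) B p q x))).
  apply: smooth_onM => //.
    apply: smooth_onV => //; last exact: smooth_on_det.
    by move=> x Wx; have := uA x Wx; rewrite unitmxE unitfE.
  apply: smooth_onM => //; first exact: smooth_on_cst.
  by apply: smooth_on_det => // p q; exact: sA.
apply: smooth_on_eq => // x Wx; rewrite /invmx uA// !mxE /cofactor.
by congr (_ * (_ * \det _)); apply/matrixP => p q; rewrite !mxE.
Qed.

(** The support condition is expressed by an open W on which chi vanishes and which covers X
    together with U: smoothness of a product with chi can then be tested on U and on W separately. W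
    is the complement of the image of a compact ball of a chart, and this image is closed because X
    is Hausdorff. *)
Lemma smooth_bump x0 U : open U -> U x0 -> exists chi : X -> R, exists V W : set X,
  [/\ smooth chi, open V /\ V x0, forall x, V x -> chi x = 1,
      open W & (forall x, W x -> chi x = 0) /\ forall x, U x \/ W x].
Proof.
move=> oU Ux0; have [c ac dx0] := atlas_cover x0.
set z0 := chart_map c x0; set O := chart_map c @` (chart_dom c `&` U).
have Oz0 : nbhs z0 O.
  by apply: open_nbhs_nbhs; split; [exact: chart_image_open|exists x0].
have [e /= e0 eO] := (nbhs_ballP _ _).1 Oz0.
(* The squared Euclidean distance is polynomial, whereas the balls of row vectors come from the sup
   norm. With rho = (e/2)^2 the set g <= rho has all coordinates within e/2 of the centre, hence
   lies in the ball of radius e. *)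
pose g (z : 'rV[R]_m) := \sum_i (z ord0 i - z0 ord0 i) ^+ 2.
have cg : continuous g.
  rewrite /g => z; elim: (index_enum _) => [|i s IH].
    under eq_fun do rewrite big_nil; exact: cst_continuous.
  under eq_fun do rewrite big_cons.
  apply: continuousD IH.
  apply: (@continuous_comp _ _ _ (fun z : 'rV[R]_m => z ord0 i - z0 ord0 i) (fun t => t
    ^+ 2)).
    by apply: continuousB; [exact: coord_continuous|exact: cst_continuous].
  exact: exprn_continuous.
pose rho := (e / 2) ^+ 2.
have rho0 : 0 < rho by rewrite exprn_gt0 ?divr_gt0.
pose B := [set z | g z <= rho].
have gB z i : B z -> `|z ord0 i - z0 ord0 i| <= e / 2.
  move=> Bz; rewrite -(ler_pXn2r (n := 2))// ?nnegrE ?divr_ge0 ?(ltW e0)//.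
  rewrite real_normK ?num_real//; apply: (le_trans _ (Bz : g z <= rho)).
  by rewrite /g (bigD1 i)//= lerDl sumr_ge0// => j _; exact: sqr_ge0.
have Bball z : B z -> ball z0 e z.
  move=> Bz; split=> // i j; rewrite [i]ord1 /ball /= distrC.
  by apply: le_lt_trans (gB z j Bz) _; rewrite ltr_pdivrMr// ltr_pMr// ltrDl.
have BO : B `<=` O by move=> z /Bball; exact: eO.
have cB : compact B.
  apply: bounded_closed_compact; last first.
    apply: (@closed_comp _ _ g [set t | t <= rho]); last exact: closed_le.
    by move=> ? _; exact: cg.
  exists (`|z0| + e); split; first exact: num_real.
  move=> M ltM z /Bball; rewrite -ball_normE /= => zz0; apply: le_trans (ltW ltM).
  rewrite -[z](subrK z0) addrC; apply: le_trans (ler_normD _ _) _.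
  by rewrite lerD2l distrC ltW.
pose K := chart_inv c @` B.
have KU x : K x -> chart_dom c x /\ U x.
  by case=> _ /BO[y [dy Uy] <-] <-; rewrite chart_mapK.
have clK : closed K.
  apply: compact_closed; first exact: carrier_hausdorff.
  apply: continuous_compact cB; apply: continuous_in_subspaceT => z.
  rewrite inE => /BO[y [dy Uy] <-]; apply: chart_inv_continuous; by exists y.
pose G x := g (chart_map c x).
(* The quotient is 1 where G <= rho/2 and 0 where G >= rho; since rho/2 < rho, the two terms of the
   denominator never vanish together. *)
pose chi x := if x \in chart_dom c then
  expflat 0 (rho - G x) * (expflat 0 (rho - G x) + expflat 0 (G x - rho / 2))^-1 else 0.
pose V := chart_dom c `&` [set x | G x < rho / 2].
have WK0 x : (~` K) x -> chi x = 0.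
  rewrite /chi => nKx; case: ifPn => //; rewrite inE => dx.
  rewrite expflat_npos ?mul0r// subr_le0 leNgt; apply/negP => /ltW Gx.
  by apply: nKx; exists (chart_map c x) => //; exact: chart_mapK.
exists chi, V, (~` K); split.
- apply: smooth_on_cover => x _.
  have [dx|ndx] := pselect (chart_dom c x); last first.
    exists (~` K); first by move=> /KU[].
    apply: (smooth_on_eq _ _ (smooth_on_cst 0 _)); try exact: closed_openC.
    by move=> y Ky; rewrite WK0.
  have od := chart_dom_open c.
  exists (chart_dom c) => //.
  have sG : smooth_on (chart_dom c) G.
    apply: smooth_on_sum => // i _.
    have s1 : smooth_on (chart_dom c) (fun y => chart_map c y ord0 i - z0 ord0 i).
      by apply: smooth_onB => //; [exact: smooth_on_chart_coord|exact: smooth_on_cst].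
    by apply: smooth_on_eq (smooth_onM od s1 s1) => // y _; rewrite expr2.
  have s1 : smooth_on (chart_dom c) (fun y => rho - G y).
    by apply: smooth_onB => //; exact: smooth_on_cst.
  have s2 : smooth_on (chart_dom c) (fun y => G y - rho / 2).
    by apply: smooth_onB => //; exact: smooth_on_cst.
  have : smooth_on (chart_dom c) (fun x =>
      expflat 0 (rho - G x) * (expflat 0 (rho - G x) + expflat 0 (G x - rho / 2))^-1).
    apply: smooth_onM => //; first exact: smooth_on_expflat.
    apply: smooth_onV => //; last by apply: smooth_onD => //; exact: smooth_on_expflat.
    move=> y _; rewrite gt_eqF//; have [Gy|Gy] := ltP (G y) rho.
      by rewrite ltr_wpDr ?expflat_ge0// expflat_gt0// subr_gt0.
    rewrite ltr_wpDl ?expflat_ge0// expflat_gt0// subr_gt0.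
    by apply: lt_le_trans Gy; rewrite ltr_pdivrMr// ltr_pMr// ltrDl.
  by apply: smooth_on_eq => // y dy; rewrite /chi mem_set.
- split; last by split=> //=; rewrite /G /g big1 ?divr_gt0// => i _; rewrite subrr expr0n.
  rewrite openE => x [dx Gx]; apply: filterI.
    by apply: open_nbhs_nbhs; split=> //; exact: chart_dom_open.
  have cG : {for x, continuous G}.
    by apply: continuous_comp; [exact: chart_map_continuous|exact: cg].
  exact: (cG [set t | t < rho / 2] (lt_nbhsl Gx)).
- move=> x [dx Gx]; rewrite /chi mem_set// [expflat 0 (G x - _)]expflat_npos.
    rewrite addr0 divff// gt_eqF// expflat_gt0// subr_gt0.
    by apply: lt_trans Gx _; rewrite ltr_pdivrMr// ltr_pMr// ltrDl.
  by rewrite subr_le0 ltW.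
- exact: closed_openC.
- split=> // x; have [Kx|Kx] := pselect (K x); [left|by right].
  by have [] := KU x Kx.
Qed.

End SmoothFunctions.

(** * Sections and dual frames *)

Section Sections.
Variables (R : realType) (m : nat) (X : smooth_manifold R m).
Variables (r : nat) (E : vector_bundle X r).
Implicit Types (U V W : set X) (f : X -> R) (s t : sec E).

Lemma smooth_sec_on_sub U W s : W `<=` U -> smooth_sec_on U s -> smooth_sec_on W s.
Proof.
move=> WU ss F FF; have [g sg sE] := ss F FF; exists g.
  by move=> i; apply: smooth_on_sub (sg i) => x [Fx /WU].
by move=> x Fx /WU; exact: sE.
Qed.

Lemma smooth_sec_smooth_sec_on W s : smooth_sec s -> smooth_sec_on W s.
Proof. exact: smooth_sec_on_sub. Qed.

Lemma smooth_sec_on0 W : open W -> smooth_sec_on W (fun x => 0 : E x).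
Proof.
move=> oW F FF; exists (fun=> fun=> 0).
  by move=> i; apply: smooth_on_cst; apply: openI => //; exact: frames_open.
by move=> x _ _; rewrite big1// => i _; rewrite scale0r.
Qed.

Lemma smooth_sec_onD W s t : open W -> smooth_sec_on W s -> smooth_sec_on W t ->
  smooth_sec_on W (fun x => s x + t x).
Proof.
move=> oW ss st F FF; have [g sg sE] := ss F FF; have [h sh tE] := st F FF.
exists (fun i x => g i x + h i x).
  by move=> i; apply: smooth_onD => //; apply: openI => //; exact: frames_open.
move=> x Fx Wx; rewrite sE// tE// -big_split /=.
by apply: eq_bigr => i _; rewrite scalerDl.
Qed.

Lemma smooth_sec_onZ W f s : open W -> smooth_on W f -> smooth_sec_on W s ->
  smooth_sec_on W (fun x => f x *: s x).
Proof.
move=> oW sf ss F FF; have [g sg sE] := ss F FF.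
exists (fun i x => f x * g i x).
  move=> i; apply: smooth_onM => //; first by apply: openI => //; exact: frames_open.
  by apply: smooth_on_sub sf => x [].
move=> x Fx Wx; rewrite sE// scaler_sumr.
by apply: eq_bigr => i _; rewrite scalerA.
Qed.

Lemma smooth_sec_on_sum W k (s : 'I_k -> sec E) : open W ->
  (forall i, smooth_sec_on W (s i)) ->
  smooth_sec_on W (fun x => \sum_i s i x).
Proof.
move=> oW ss.
suff H (q : seq 'I_k) : smooth_sec_on W (fun x => \sum_(i <- q) s i x) by exact: H.
elim: q => [|i q IH].
  suff -> : (fun x => \sum_(i <- [::]) s i x) = (fun x => 0) by exact: smooth_sec_on0.
  by apply: functional_extensionality_dep => x; rewrite big_nil.
suff -> : (fun x => \sum_(j <- i :: q) s j x) = (fun x => s i x + \sum_(j <- q) s j x).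
  exact: smooth_sec_onD.
by apply: functional_extensionality_dep => x; rewrite big_cons.
Qed.

Lemma smooth_secP (a : R) s t : smooth_sec s -> smooth_sec t ->
  smooth_sec (fun x => a *: s x + t x).
Proof.
move=> ss st; apply: smooth_sec_onD => //; first exact: openT.
by apply: smooth_sec_onZ => //; [exact: openT|apply: smooth_on_cst; exact: openT].
Qed.

(** Off U, where nothing is known of s, the covering puts the point in W and f vanishes; the
    coefficients f g_i are therefore smooth everywhere. *)
Lemma smooth_sec_extend U W f s : open U -> open W -> smooth f ->
  (forall x, W x -> f x = 0) -> (forall x, U x \/ W x) ->
  smooth_sec_on U s -> smooth_sec (fun x => f x *: s x).
Proof.
move=> oU oW sf f0 UW ss F FF; have [g sg sE] := ss F FF.
have oF := frames_open FF.
exists (fun i x => f x * g i x).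
  move=> i; apply: smooth_on_cover => x [Fx _]; have [Ux|Wx] := UW x.
    exists (F.1 `&` U) => //; apply: smooth_onM => //; first exact: openI.
    exact: smooth_smooth_on.
  exists W => //; apply: (smooth_on_eq oW _ (smooth_on_cst 0 oW)) => y Wy.
  by rewrite f0// mul0r.
move=> x Fx _; have [Ux|Wx] := UW x.
  by rewrite sE// scaler_sumr; apply: eq_bigr => i _; rewrite scalerA.
by rewrite f0// scale0r big1// => i _; rewrite mul0r scale0r.
Qed.

(** The frame in the definition of a subbundle is smooth on U only. A cutoff turns it into global
    sections of L and leaves it unchanged near x0. *)
Lemma subbundle_frame (L : forall x, {vspace E x}) x0 : subbundle L ->
  exists U k (l : 'I_k -> sec E), [/\ open U, U x0, forall i, sec_in L (l i) &
    forall x, U x -> basis_of (L x) [tuple l i x | i < k]].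
Proof.
move=> /(_ x0)[U [k [l [oU Ux0 sl bl]]]].
have [chi [V [W [schi [oV Vx0] chi1 oW [chi0 UW]]]]] := smooth_bump oU Ux0.
have chiU x : chi x != 0 -> U x.
  by have [//|Wx] := UW x; rewrite chi0// eqxx.
exists V, k, (fun i x => chi x *: l i x); split=> //.
  move=> i; split; first exact: (smooth_sec_extend oU oW schi chi0 UW (sl i)).
  move=> x; have [->|/chiU Ux] := eqVneq (chi x) 0; first by rewrite scale0r mem0v.
  rewrite rpredZ//; apply: (basis_mem (bl x Ux)).
  by apply/tnthP; exists i; rewrite tnth_mktuple.
move=> x Vx.
have -> : [tuple chi x *: l i x | i < k] = [tuple l i x | i < k].
  by apply: eq_from_tnth => i; rewrite !tnth_mktuple chi1// scale1r.
by apply: bl; apply: chiU; rewrite chi1// oner_eq0.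
Qed.

End Sections.

(** * Linear algebra of the pairing and construction of dual frames *)

Section Pairing.
Variables (R : realType) (m : nat) (X : smooth_manifold R m).
Variables (r : nat) (E : vector_bundle X r) (C : courant_algebroid E).
Local Notation "<< u , v >>" := (pairing C u v).

Lemma pairing0l x (v : E x) : << 0, v >> = 0.
Proof.
by have := pairingP C 1 0 0 v; rewrite scale1r add0r mul1r => /eqP; rewrite addrC
  -subr_eq subrr => /eqP.
Qed.

Lemma pairingDl x (u v w : E x) : << u + v, w >> = << u, w >> + << v, w >>.
Proof. by rewrite -[u]scale1r pairingP mul1r scale1r. Qed.

Lemma pairingZl x a (u w : E x) : << a *: u, w >> = a * << u, w >>.
Proof. by rewrite -[_ *: _]addr0 pairingP pairing0l addr0. Qed.

Lemma pairingDr x (u v w : E x) : << u, v + w >> = << u, v >> + << u, w >>.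
Proof. by rewrite pairingC pairingDl !(pairingC _ u). Qed.

Lemma pairingZr x a (u w : E x) : << w, a *: u >> = a * << w, u >>.
Proof. by rewrite pairingC pairingZl pairingC. Qed.

Lemma pairingNl x (u w : E x) : << - u, w >> = - << u, w >>.
Proof. by rewrite -scaleN1r pairingZl mulN1r. Qed.

Lemma pairingBl x (u v w : E x) : << u - v, w >> = << u, w >> - << v, w >>.
Proof. by rewrite pairingDl pairingNl. Qed.

Lemma pairingBr x (u v w : E x) : << w, u - v >> = << w, u >> - << w, v >>.
Proof. by rewrite pairingC pairingBl !(pairingC C w). Qed.

Lemma pairing_suml x k (u : 'I_k -> E x) w : << \sum_i u i, w >> = \sum_i << u i, w >>.
Proof.
apply: (big_morph (fun z => << z, w >>)) => [u' v'|]; first exact: pairingDl.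
exact: pairing0l.
Qed.

Lemma pairing_sumr x k (u : 'I_k -> E x) w : << w, \sum_i u i >> = \sum_i << w, u i >>.
Proof. by rewrite pairingC pairing_suml; under eq_bigr do rewrite pairingC. Qed.

Variables (L M : forall x, {vspace E x}).
Hypotheses (hL : lagrangian C L) (hM : lagrangian C M) (hLM : complementary L M).

Lemma lagrangian_isotropic (N : forall x, {vspace E x}) x u v : lagrangian C N ->
  u \in N x -> v \in N x -> << u, v >> = 0.
Proof. by move=> [_ /(_ x u)[h _]] /h; apply. Qed.

Lemma complementary_eq0 x u : u \in L x -> u \in M x -> u = 0.
Proof.
move=> Lu Mu; have [_ h] := hLM x; apply/eqP.
by rewrite -memv0 -h memv_cap Lu.
Qed.

Lemma orthogonal_complementary_eq0 x u :
  (forall v, v \in L x -> << u, v >> = 0) -> (forall v, v \in M x -> << u, v >> = 0) ->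
  u = 0.
Proof.
by move=> /(hL.2 x u).2 Lu /(hM.2 x u).2; exact: complementary_eq0.
Qed.

Lemma basis_pairing_eq0 (N : forall x, {vspace E x}) x k (l : 'I_k -> sec E) u :
  basis_of (N x) [tuple l i x | i < k] -> (forall i, << u, l i x >> = 0) ->
  forall v, v \in N x -> << u, v >> = 0.
Proof.
move=> bl ul v; rewrite -(span_basis bl) => /coord_span ->.
rewrite pairing_sumr big1// => i _.
by rewrite pairingZr -tnth_nth tnth_mktuple ul mulr0.
Qed.

(** A combination of the l_i given by a row in the kernel is orthogonal to P, and to N because N is
    isotropic, so it is zero. *)
Lemma pairing_matrix_free (N P : forall x, {vspace E x}) x k k'
    (l : 'I_k -> sec E) (p : 'I_k' -> sec E) :
  (forall u, (forall v, v \in N x -> << u, v >> = 0) -> (forall v, v \in P x -> << u, v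
    >> = 0) -> u = 0) ->
  lagrangian C N ->
  basis_of (N x) [tuple l i x | i < k] -> basis_of (P x) [tuple p i x | i < k'] ->
  row_free (\matrix_(i, j) << l i x, p j x >>).
Proof.
move=> ortho lN bl bp; apply: inj_row_free => v v0.
have lNx i : l i x \in N x.
  by apply: (basis_mem bl); apply/tnthP; exists i; rewrite tnth_mktuple.
have u0 : \sum_i v ord0 i *: l i x = 0.
  apply: ortho => w Nw.
    rewrite pairing_suml big1// => i _.
    by rewrite pairingZl (lagrangian_isotropic lN)// mulr0.
  apply: (basis_pairing_eq0 bp _ Nw) => j; rewrite pairing_suml.
  have := congr1 (fun B : 'rV_k' => B ord0 j) v0; rewrite !mxE => e0; rewrite -[RHS]e0.
  by apply: eq_bigr => i _; rewrite pairingZl mxE.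
have /freeP fl := basis_free bl.
apply/rowP => i; rewrite mxE; apply: (fl (fun i => v ord0 i)).
by rewrite -[RHS]u0; apply: eq_bigr => j _; rewrite -tnth_nth tnth_mktuple.
Qed.

(** The dual frame is obtained from any local frame q of M by the inverse of the matrix <l_i,
    q_j>. *)
Lemma dual_frame x0 U k (l : 'I_k -> sec E) : open U -> U x0 ->
  (forall i, sec_in L (l i)) ->
  (forall x, U x -> basis_of (L x) [tuple l i x | i < k]) ->
  exists V (p : 'I_k -> sec E), [/\ open V /\ V x0, V `<=` U,
    forall j, sec_in M (p j) &
    forall x, V x -> forall i j, << l i x, p j x >> = (i == j)%:R].
Proof.
move=> oU Ux0 Ll bl; have [U' [k' [q [oU' U'x0 Mq bq]]]] := subbundle_frame x0 hM.1.
have fA x : U x -> U' x -> row_free (\matrix_(i < k, j < k') << l i x, q j x >>).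
  by move=> Ux U'x; apply: pairing_matrix_free (bl x Ux) (bq x U'x) => //; exact:
    orthogonal_complementary_eq0.
have fAt : row_free (\matrix_(i < k', j < k) << q i x0, l j x0 >>).
  apply: (pairing_matrix_free (N := M) (P := L)) (bl x0 Ux0) => //; last exact: bq.
  by move=> u Mu Lu; exact: orthogonal_complementary_eq0.
(* The ranks of L and M are not given as equal; the two matrices of pairings have independent rows,
   which yields both inequalities. *)
have kk' : k = k'.
  apply/eqP; rewrite eqn_leq -{1}(eqP (fA x0 Ux0 U'x0)) rank_leq_col /=.
  by rewrite -(eqP fAt) rank_leq_col.
subst k'.
have oV := openI oU oU'.
have [chi [V [W [schi [oV' Vx0] chi1 oW [chi0 UW]]]]] := smooth_bump oV (conj Ux0 U'x0).
have VU x : V x -> U x /\ U' x.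
  by move=> Vx; have [//|Wx] := UW x; have := oner_neq0 R; rewrite -(chi1 x Vx) chi0//
    eqxx.
have uA x : (U `&` U') x -> \matrix_(i, j) << l i x, q j x >> \in unitmx.
  by move=> [Ux U'x]; rewrite -row_free_unit fA.
exists V, (fun j x => chi x *: \sum_i invmx (\matrix_(i, j) << l i x, q j x >>) i j *:
  q i x).
split=> //.
- by move=> x /VU[].
- move=> j; split; last first.
    by move=> x; rewrite rpredZ// rpred_sum// => i _; rewrite rpredZ// (Mq i).2.
  apply: (smooth_sec_extend oV oW schi chi0 UW).
  apply: smooth_sec_on_sum => // i; apply: smooth_sec_onZ => //.
    apply: (smooth_on_invmx (A := fun i j x => << l i x, q j x >>)) => // i' j'.
    by apply: smooth_smooth_on; apply: pairing_smooth; [exact: (Ll i').1|exact: (Mq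
      j').1].
  exact: smooth_sec_smooth_sec_on (Mq i).1.
- move=> x Vx i j; rewrite chi1// scale1r pairing_sumr.
  have /uA/mulmxV/(congr1 (fun B : 'M[R]_k => B i j)) := VU x Vx.
  rewrite !mxE => <-; apply: eq_bigr => i' _.
  by rewrite pairingZr mulrC mxE.
Qed.

End Pairing.

(** * Forms and multivectors *)

Section WedgeProducts.
Variables (R : realType) (V : Type).
Implicit Types (a b : seq V -> R) (s : seq V).

Lemma wedge_prod0l a b s : (forall t, a t = 0) -> wedge_prod a b s = 0.
Proof.
elim: s a b => [|e s IH] a b a0 /=; first by rewrite a0 mul0r.
by rewrite !IH ?addr0// => t; rewrite a0 mulr0.
Qed.

Lemma wedge_prod0r a b s : (forall t, b t = 0) -> wedge_prod a b s = 0.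
Proof.
elim: s a b => [|e s IH] a b b0 /=; first by rewrite b0 mulr0.
by rewrite !IH ?addr0.
Qed.

Lemma wedge_prod_scalar (c : R) b s :
  wedge_prod (fun t => c * unit_form R t) b s = c * b s.
Proof.
elim: s b => [|e s IH] b /=; first by rewrite mulr1.
rewrite [X in X + _]wedge_prod0l ?add0r; last by move=> t; rewrite mulr0.
rewrite -[RHS](IH (fun t => b (e :: t))); congr (wedge_prod _ _ _).
by apply/funext => -[|x t] /=; rewrite ?expr0 ?mul1r// !mulr0.
Qed.

Lemma wedge_prod_unit a s : wedge_prod a (@unit_form R V) s = a s.
Proof.
elim: s a => [|e s IH] a /=; first by rewrite mulr1.
by rewrite IH wedge_prod0r ?addr0.
Qed.

End WedgeProducts.

Lemma sum_concat (R : realType) k1 k2 (F : 'I_k1 -> R) (G : 'I_k2 -> R) :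
  \sum_i F i + \sum_i G i =
  \sum_(i < k1 + k2) match fintype.split i with inl j => F j | inr j => G j end.
Proof.
rewrite big_split_ord /=; congr (_ + _); apply: eq_bigr => i _.
  by have -> := unsplitK (inl i : 'I_k1 + 'I_k2)%type.
by have -> := unsplitK (inr i : 'I_k1 + 'I_k2)%type.
Qed.

Section Multivectors.
Variables (R : realType) (m : nat) (X : smooth_manifold R m).
Variables (r : nat) (E : vector_bundle X r) (C : courant_algebroid E).
Variable L : forall x, {vspace E x}.
Local Notation "<< u , v >>" := (pairing C u v).

Lemma wedge_prodNl x (a b : seq (E x) -> R) s :
  wedge_prod (fun t => - a t) b s = - wedge_prod a b s.
Proof.
elim: s a b => [|e s IH] a b /=; first by rewrite mulNr.
rewrite opprD -!IH; congr (_ + _); congr (wedge_prod _ _ _).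
by apply/funext => t; rewrite mulrN.
Qed.

(** Contraction with e is an antiderivation. The sign comes from the factor (-1)^|t| in
    [wedge_prod], which is -1 on the only length where a covector is nonzero. *)
Lemma wedge_covector_cons x (v e : E x) b s :
  wedge_prod (covector C v) b (e :: s) =
  << v, e >> * b s - wedge_prod (covector C v) (fun t => b (e :: t)) s.
Proof.
rewrite /=; congr (_ + _).
  rewrite -wedge_prod_scalar; congr (wedge_prod _ _ _).
  by apply/funext => -[|u t] /=; rewrite ?mulr1 ?mulr0.
rewrite -wedge_prodNl; congr (wedge_prod _ _ _).
by apply/funext => -[|u [|u' t]] /=; rewrite ?mulr0 ?oppr0// expr1 mulN1r.
Qed.

Lemma wedge_covector_nil x (v : E x) b : wedge_prod (covector C v) b [::] = 0.
Proof. by rewrite /= mul0r. Qed.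

Lemma wedge_covectorP x (v : E x) (a : R) b b1 b2 s :
  (forall t, b t = a * b1 t + b2 t) ->
  wedge_prod (covector C v) b s =
  a * wedge_prod (covector C v) b1 s + wedge_prod (covector C v) b2 s.
Proof.
elim: s b b1 b2 => [|e s IH] b b1 b2 h.
  by rewrite !wedge_covector_nil mulr0 addr0.
rewrite !wedge_covector_cons h (IH _ (fun t => b1 (e :: t)) (fun t => b2 (e :: t)))//.
ring.
Qed.

(* Multilinear forms on E_x / L_x, which is dual to L_x. *)
Definition multilinear_mod x (w : seq (E x) -> R) : Prop :=
  (forall s1 s2 (a : R) u v,
     w (s1 ++ (a *: u + v) :: s2) = a * w (s1 ++ u :: s2) + w (s1 ++ v :: s2)) /\
  (forall s1 s2 u, u \in L x -> w (s1 ++ u :: s2) = 0).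

Hypothesis isoL : forall x (u v : E x), u \in L x -> v \in L x -> << u, v >> = 0.

(** The covector of v in L kills L because L is isotropic; contraction with the first argument
    carries both properties through the product. *)
Lemma multilinear_mod_wedge x (v : E x) b : v \in L x -> multilinear_mod b ->
  multilinear_mod (wedge_prod (covector C v) b).
Proof.
move=> Lv [bD b0]; split.
  move=> s1; elim: s1 b bD {b0} => [|e s1 IH] b bD s2 a u w; rewrite ?cat0s ?cat_cons
    !wedge_covector_cons.
    rewrite (wedge_covectorP _ (b1 := fun t => b (u :: t)) (b2 := fun t => b (w :: t))
      (a := a)).
      by rewrite pairingDr pairingZr; ring.
    by move=> t; exact: (bD [::]).
  rewrite bD IH; first by ring.
  by move=> s1' s2' a' u' v'; exact: (bD (e :: s1')).
move=> s1; elim: s1 b b0 {bD} => [|e s1 IH] b b0 s2 u Lu; rewrite ?cat0s ?cat_cons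
  !wedge_covector_cons.
  rewrite isoL// mul0r sub0r wedge_prod0r ?oppr0// => t; exact: (b0 [::]).
rewrite b0// mulr0 sub0r IH ?oppr0// => s1' s2' u' Lu'; exact: (b0 (e :: s1')).
Qed.

Lemma multilinear_mod_multivector x (w : seq (E x) -> R) :
  multivector C L w -> multilinear_mod w.
Proof.
move=> [k [c [ls [Lls wE]]]].
have wl i : multilinear_mod (wedge_seq C (ls i)).
  elim: (ls i) (Lls i) => [|v s IH] /=.
    by split=> s1 s2; case: s1 => [|? ?] *; rewrite /= ?mulr0 ?addr0.
  by move=> /andP[Lv /IH]; exact: multilinear_mod_wedge.
split=> s1 s2.
  move=> a u v; rewrite !wE mulr_sumr -big_split /=; apply: eq_bigr => i _.
  by rewrite (wl i).1; ring.
by move=> u Lu; rewrite wE big1// => i _; rewrite (wl i).2// mulr0.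
Qed.

Lemma wedge_covector_degree x (v : E x) n b s :
  (forall t, size t <> n -> b t = 0) -> size s <> n.+1 ->
  wedge_prod (covector C v) b s = 0.
Proof.
elim: s b n => [|e s IH] b n bn sn; first exact: wedge_covector_nil.
rewrite wedge_covector_cons bn; last by move=> h; apply: sn => /=; rewrite h.
rewrite mulr0 sub0r; case: n bn sn => [|n] bn sn.
  by rewrite wedge_prod0r ?oppr0// => t; exact: bn.
rewrite (IH _ n) ?oppr0//; last by move=> h; apply: sn => /=; rewrite h.
by move=> t tn; apply: bn => /= -[].
Qed.

Lemma wedge_seq_degree x (vs s : seq (E x)) : size s <> size vs -> wedge_seq C vs s = 0.
Proof.
elim: vs s => [|v vs IH] s; first by case: s.
exact: wedge_covector_degree.
Qed.

Lemma multivectorP x (a : R) (w w' : seq (E x) -> R) :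
  multivector C L w -> multivector C L w' -> multivector C L (fun s => a * w s + w' s).
Proof.
move=> [k [c [ls [Lls wE]]]] [k' [c' [ls' [Lls' wE']]]].
exists (k + k')%N, (fun i => match fintype.split i with inl j => a * c j | inr j => c'
  j end),
  (fun i => match fintype.split i with inl j => ls j | inr j => ls' j end); split.
  by move=> i; case: (fintype.split i).
move=> s; rewrite wE wE' mulr_sumr sum_concat; apply: eq_bigr => i _.
by case: (fintype.split i) => j //; rewrite mulrA.
Qed.

Lemma multivector_wedge_seq x (vs : seq (E x)) : all (fun v => v \in L x) vs ->
  multivector C L (wedge_seq C vs).
Proof.
move=> Lvs; exists 1%N, (fun=> 1), (fun=> vs); split=> // s.
by rewrite big_ord1 mul1r.
Qed.

Implicit Types (a b w : form_field E).

Lemma gamP (c : R) a b : gam C L a -> gam C L b -> gam C L (c *: a + b).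
Proof.
move=> [ma sa] [mb sb]; split=> [x|k e se]; first exact: multivectorP.
apply: smooth_onD; [exact: openT| |exact: sb].
by apply: smooth_onM; [exact: openT|apply: smooth_on_cst; exact: openT|exact: sa].
Qed.

Lemma gam0 : gam C L 0.
Proof.
split=> [x|k e se].
  exists 0%N, (fun=> 0), (fun=> [::]); split; first by [].
  by move=> s; rewrite big_ord0.
by apply: smooth_on_cst; exact: openT.
Qed.

Lemma gamZ (c : R) a : gam C L a -> gam C L (c *: a).
Proof. by move=> ga; have := gamP c ga gam0; rewrite addr0. Qed.

Lemma gamD a b : gam C L a -> gam C L b -> gam C L (a + b).
Proof. by move=> ga gb; have := gamP 1 ga gb; rewrite scale1r. Qed.

Lemma gam_sum k (a : 'I_k -> form_field E) : (forall i, gam C L (a i)) ->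
  gam C L (\sum_i a i).
Proof. by move=> ga; apply: (big_ind _ gam0 gamD). Qed.

Lemma smooth_unit_form (es : seq (sec E)) :
  smooth (fun x => unit_form R [seq e x | e <- es]).
Proof. by case: es => [|e es] /=; apply: smooth_on_cst; exact: openT. Qed.

(** The induction on the arguments contracts b with a section, so the auxiliary statement [sW]
    concerns arbitrary families b with smooth values on lists of smooth sections. *)
Lemma smooth_wedge_seq (ls es : seq (sec E)) :
  (forall i, (i < size ls)%N -> smooth_sec (nth (fun=> 0) ls i)) ->
  (forall i, (i < size es)%N -> smooth_sec (nth (fun=> 0) es i)) ->
  smooth (fun x => wedge_seq C [seq l x | l <- ls] [seq e x | e <- es]).
Proof.
have oT := @openT X.
pose smooth_secs (q : seq (sec E)) :=
  forall i, (i < size q)%N -> smooth_sec (nth (fun=> 0) q i).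
pose smooth_form (b : forall x, seq (E x) -> R) :=
  forall es, smooth_secs es -> smooth (fun x => b x [seq e x | e <- es]).
rewrite -/(smooth_secs _) -/(smooth_secs _).
have sW l (b : forall x, seq (E x) -> R) : smooth_sec l -> smooth_form b ->
    smooth_form (fun x => wedge_prod (covector C (l x)) (b x)).
  move=> sl + q; elim: q b => [|e q IH] b sb sq.
    suff -> : (fun x => wedge_prod (covector C (l x)) (b x) [::]) = (fun=> 0).
      exact: smooth_on_cst.
    by apply/funext => x; rewrite wedge_covector_nil.
  have se : smooth_sec e by exact: (sq 0%N).
  have sq' : smooth_secs q by move=> i iq; exact: (sq i.+1).
  suff -> : (fun x => wedge_prod (covector C (l x)) (b x) [seq e x | e <- e :: q]) =
     (fun x => << l x, e x >> * b x [seq e x | e <- q] -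
        wedge_prod (covector C (l x)) (fun t => b x (e x :: t)) [seq e x | e <- q]).
    apply: smooth_onB => //.
      by apply: smooth_onM => //; [exact: pairing_smooth|exact: sb].
    apply: (IH (fun x t => b x (e x :: t))) => // q2 sq2.
    by apply: (sb (e :: q2)) => -[|i] //= ?; exact: sq2.
  by apply/funext => x; rewrite map_cons wedge_covector_cons.
suff H : smooth_secs ls -> smooth_form (fun x => wedge_seq C [seq l x | l <- ls]) by
  move=> /H; apply.
elim: ls => [|l ls IH] sls; first by move=> q _; exact: smooth_unit_form.
apply: (sW l (fun x => wedge_seq C [seq l x | l <- ls])); first exact: (sls 0%N).
by apply: IH => i il; exact: (sls i.+1).
Qed.

Lemma gamk_wedge_sec (ls : seq (sec E)) :
  (forall i, (i < size ls)%N -> sec_in L (nth (fun=> 0) ls i)) ->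
  gamk C L (size ls) (wedge_sec C ls).
Proof.
move=> Lls; split; last by move=> x s sn; apply: wedge_seq_degree; rewrite size_map.
split.
  move=> x; apply: (@multivector_wedge_seq x [seq l x | l <- ls]); apply/(all_nthP 0)
    => i.
  rewrite size_map => il; rewrite (nth_map (fun=> 0))//; exact: (Lls i il).2.
move=> k e se.
have /(_ [seq e i | i <- enum 'I_k]) := @smooth_wedge_seq ls.
suff -> : (fun x => wedge_seq C [seq l x | l <- ls] [seq e0 x | e0 <- [seq e i | i <-
  enum 'I_k]]) =
  (fun x => at_pt (wedge_sec C ls) [seq e i x | i <- enum 'I_k]).
  apply=> i; first by move=> il; exact: (Lls i il).1.
  rewrite size_map => il; case: k e se il => [|k] e se il; first by rewrite
    size_enum_ord in il.
  by rewrite (nth_map ord0).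
by apply/funext => x; rewrite -map_comp.
Qed.

Lemma gamk_fn f : smooth f -> gamk C L 0 (fn f : form_field E).
Proof.
move=> sf; split; last first.
  by move=> x [|? ?] //= _; rewrite /at_pt /fn /mkfield /= mulr0.
split.
  move=> x; exists 1%N, (fun=> f x), (fun=> [::]); split=> // s.
  by rewrite big_ord1.
move=> k e se; apply: smooth_onM; [exact: openT|exact: sf|].
suff -> : (fun x => unit_form R [seq e i x | i <- enum 'I_k]) =
  (fun x => unit_form R [seq e0 x | e0 <- [seq e i | i <- enum 'I_k]]).
  exact: smooth_unit_form.
by apply/funext => x; rewrite -[in RHS]map_comp.
Qed.

End Multivectors.

(** The derivation is only known on global functions and its locality has to be derived: the Leibniz
    rule for chi (f - c) = 0, with chi(x) = 1 and f(x) = c, leaves D f = 0. *)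
Lemma tangent_vector_locally_cst (R : realType) (m : nat) (X : smooth_manifold R m)
    (x : X) D (V : set X) (c : R) f :
  tangent_vector x D -> smooth f -> open V -> V x -> (forall y, V y -> f y = c) ->
  D f = 0.
Proof.
move=> [Dlin Dmul] sf oV Vx fc.
have oT := @openT X.
have scst (a : R) : smooth (X := X) (fun=> a) by exact: smooth_on_cst.
have D0 : D (fun=> 0) = 0.
  have := Dlin 1 (fun=> 0) (fun=> 0) (scst 0) (scst 0).
  under eq_fun do rewrite mulr0 addr0.
  by rewrite mul1r => /eqP; rewrite -subr_eq subrr => /eqP.
have D1 : D (fun=> 1) = 0.
  have := Dmul (fun=> 1) (fun=> 1) (scst 1) (scst 1).
  under eq_fun do rewrite mulr1.
  by rewrite mulr1 mul1r => /eqP; rewrite -subr_eq subrr => /eqP.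
have [chi [V' [W [schi [_ V'x] chi1 _ [chi0 UW]]]]] := smooth_bump oV Vx.
have sg : smooth (fun y => - c * 1 + f y).
  by apply: smooth_onD => //; apply: smooth_onM => //; exact: scst.
have := Dmul chi _ schi sg.
have -> : (fun y => chi y * (- c * 1 + f y)) = (fun=> 0).
  apply/funext => y; have [Vy|Wy] := UW y; last by rewrite chi0// mul0r.
  by rewrite fc// mulr1 addrC subrr mulr0.
rewrite D0 Dlin// D1 (fc x)// (chi1 x)// => h.
by lra.
Qed.

Section DualExpansion.
Variables (R : realType) (m : nat) (X : smooth_manifold R m).
Variables (r : nat) (E : vector_bundle X r) (C : courant_algebroid E).
Local Notation "<< u , v >>" := (pairing C u v).
Variables (L M : forall x, {vspace E x}).
Hypotheses (hL : lagrangian C L) (hM : lagrangian C M) (hLM : complementary L M).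
Variables (x : X) (k : nat) (l p : 'I_k -> sec E).
Hypotheses (bl : basis_of (L x) [tuple l i x | i < k]) (Mp : forall i, p i x \in M x)
  (lp : forall i j, << l i x, p j x >> = (i == j)%:R).

Let Ll i : l i x \in L x.
Proof. by apply: (basis_mem bl); apply/tnthP; exists i; rewrite tnth_mktuple. Qed.

(** The difference of the two sides lies in M and is orthogonal to the frame l, hence lies in the
    orthogonal of L, which is L itself. *)
Lemma dual_expansion u : u \in M x -> u = \sum_j << u, l j x >> *: p j x.
Proof.
move=> Mu; apply/eqP; rewrite -subr_eq0; apply/eqP.
apply: (complementary_eq0 hLM); last first.
  by rewrite rpredB// rpred_sum// => i _; rewrite rpredZ.
apply/(hL.2 x) => w Lw; apply: (basis_pairing_eq0 bl _ Lw) => i.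
rewrite pairingBl pairing_suml (bigD1 i)//= pairingZl (pairingC C (p i x)) lp eqxx mulr1.
rewrite big1 ?addr0 ?subrr// => j ji.
by rewrite pairingZl (pairingC C (p j x)) lp eq_sym (negbTE ji) mulr0.
Qed.

Lemma basis_expansion u : u \in L x -> u = \sum_j << u, p j x >> *: l j x.
Proof.
move=> Lu; apply/eqP; rewrite -subr_eq0; apply/eqP.
apply: (complementary_eq0 hLM).
  by rewrite rpredB// rpred_sum// => i _; rewrite rpredZ.
apply/(hM.2 x) => w Mw; rewrite (dual_expansion Mw) pairing_sumr big1// => i _.
rewrite pairingZr pairingBl pairing_suml (bigD1 i)//= pairingZl lp eqxx mulr1.
rewrite big1 ?addr0 ?subrr ?mulr0// => j ji.
by rewrite pairingZl lp (negbTE ji) mulr0.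
Qed.

End DualExpansion.

Section WedgeValues.
Variables (R : realType) (m : nat) (X : smooth_manifold R m).
Variables (r : nat) (E : vector_bundle X r) (C : courant_algebroid E).
Local Notation "<< u , v >>" := (pairing C u v).

Lemma wedge_seq1 x (a : E x) s : wedge_seq C [:: a] s = covector C a s.
Proof. exact: wedge_prod_unit. Qed.

Lemma wedge_seq2 x (a b u v : E x) :
  wedge_seq C [:: a; b] [:: u; v] = << a, u >> * << b, v >> - << a, v >> * << b, u >>.
Proof. by rewrite /wedge_seq /=; ring. Qed.

Lemma wedge_seq3 x (a b c u v w : E x) :
  wedge_seq C [:: a; b; c] [:: u; v; w] =
  << a, u >> * (<< b, v >> * << c, w >> - << b, w >> * << c, v >>) -
  << a, v >> * (<< b, u >> * << c, w >> - << b, w >> * << c, u >>) +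
  << a, w >> * (<< b, u >> * << c, v >> - << b, v >> * << c, u >>).
Proof. by rewrite /wedge_seq /=; ring. Qed.

Lemma wedge_prod_form2_covector x (w : seq (E x) -> R) (e a b c : E x) :
  (forall s, size s <> 2 -> w s = 0) ->
  wedge_prod w (covector C e) [:: a; b; c] =
  w [:: a; b] * << e, c >> - w [:: a; c] * << e, b >> + w [:: b; c] * << e, a >>.
Proof. by move=> w0 /=; rewrite !(w0 [::], w0 [:: _], w0 [:: _; _; _])//; ring. Qed.

Lemma wedge_prod_covector_form2 x (w : seq (E x) -> R) (l a b c : E x) :
  wedge_prod (covector C l) w [:: a; b; c] =
  << l, a >> * w [:: b; c] - << l, b >> * w [:: a; c] + << l, c >> * w [:: a; b].
Proof. by rewrite /=; ring. Qed.

Lemma at_pt_sum k (a : 'I_k -> form_field E) x (s : seq (E x)) :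
  at_pt (\sum_i a i) s = \sum_i at_pt (a i) s.
Proof. by apply: (big_morph (fun w : form_field E => at_pt w s)). Qed.

Lemma fwedge_fn f (w : form_field E) x (s : seq (E x)) :
  at_pt (fwedge (fn f) w) s = f x * at_pt w s.
Proof. exact: (wedge_prod_scalar (f x)). Qed.

(** Both clauses of [gam] are local. This admits a form defined pointwise as soon as it has frame
    expressions. *)
Lemma gam_local (L : forall x, {vspace E x}) (w : form_field E) :
  (forall x0, exists V eta, [/\ open V, V x0, gam C L eta & agree_on V w eta]) ->
  gam C L w.
Proof.
move=> h; split=> [x0|k e se].
  have [V [eta [oV Vx0 [meta _] weta]]] := h x0.
  suff -> : at_pt w (x := x0) = at_pt eta (x := x0) by exact: meta.
  by apply/funext => s; exact: weta.
apply: smooth_on_cover => x _; have [V [eta [oV Vx [_ seta] weta]]] := h x.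
exists V => //.
apply: (@smooth_on_eq _ _ _ V (fun y => at_pt eta [seq e i y | i <- enum 'I_k])) => //.
  by move=> y Vy; rewrite weta.
exact/smooth_smooth_on/seta.
Qed.

End WedgeValues.

(** * The bivector of a lagrangian complement *)

Section AdaptedFrames.
Variables (R : realType) (m : nat) (X : smooth_manifold R m).
Variables (r : nat) (E : vector_bundle X r) (C : courant_algebroid E).
Local Notation "<< u , v >>" := (pairing C u v).
Variables (L M M0 : forall x, {vspace E x}).
Hypotheses (hL : lagrangian C L) (hM : lagrangian C M) (hLM : complementary L M).
Hypotheses (hM0 : lagrangian C M0) (hLM0 : complementary L M0).

(* Near each point, (l, p) and (l, p + e) are dual frames of L, M and of L, M0;
   e_j is the image of p_j under the map M -> L with graph M0. *)
Record adapted_frame (V : set X) k (l p e : 'I_k -> sec E) : Prop := AdaptedFrame {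
  adapted_open : open V;
  adapted_L : forall i, sec_in L (l i);
  adapted_M : forall i, sec_in M (p i);
  adapted_graph : forall i, sec_in L (e i);
  adapted_M0 : forall i, sec_in M0 (fun x => p i x + e i x);
  adapted_basis : forall x, V x -> basis_of (L x) [tuple l i x | i < k];
  adapted_dual : forall x, V x -> forall i j, << l i x, p j x >> = (i == j)%:R }.

(** If p in M and q in M0 are dual to the same l, then q_j - p_j is orthogonal to L, hence in L, but
    only where both dualities hold. The last cutoff makes e_j a global section of L; p_j gets the
    same factor, so that p_j + e_j = chi q_j remains in M0. *)
Lemma adapted_frame_exists x0 : exists V k (l p e : 'I_k -> sec E),
  V x0 /\ adapted_frame V l p e.
Proof.
have [U [k [l [oU Ux0 Ll bl]]]] := subbundle_frame x0 hL.1.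
have [V1 [p [[oV1 V1x0] V1U Mp dp]]] := dual_frame hL hM hLM oU Ux0 Ll bl.
have [V2 [q [[oV2 V2x0] V2U Mq dq]]] := dual_frame hL hM0 hLM0 oU Ux0 Ll bl.
have oV := openI oV1 oV2.
have [chi [V [W [schi [oV' Vx0] chi1 oW [chi0 UW]]]]] := smooth_bump oV (conj V1x0 V2x0).
have VU x : chi x != 0 -> V1 x /\ V2 x.
  by move=> chix; have [//|Wx] := UW x; rewrite chi0// eqxx in chix.
have VU1 x : V x -> V1 x /\ V2 x.
  by move=> Vx; apply: VU; rewrite chi1// oner_eq0.
have chi_in (N : forall x, {vspace E x}) s : sec_in N s -> sec_in N (fun x => chi x *:
  s x).
  move=> [ss Ns]; split; last by move=> x; rewrite rpredZ ?Ns.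
  by apply: smooth_sec_onZ => //; exact: openT.
exists V, k, (fun i x => chi x *: l i x), (fun i x => chi x *: p i x),
  (fun i x => chi x *: (-1 *: p i x + q i x)); split=> //.
split=> //; try by move=> i; exact: chi_in.
- move=> i; split.
    apply: smooth_sec_onZ; [exact: openT|exact: schi|].
    by apply: smooth_secP; [exact: (Mp i).1|exact: (Mq i).1].
  move=> x; have [->|/VU[V1x V2x]] := eqVneq (chi x) 0; first by rewrite scale0r mem0v.
  rewrite rpredZ//; apply/(hL.2 x) => w Lw.
  apply: (basis_pairing_eq0 (bl x (V1U x V1x)) _ Lw) => j.
  by rewrite pairingDl pairingZl !(pairingC C _ (l j x)) dp// dq// mulN1r addrC subrr.
- move=> i; suff -> : (fun x => chi x *: p i x + chi x *: (-1 *: p i x + q i x)) =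
      (fun x => chi x *: q i x) by exact: chi_in.
  apply: functional_extensionality_dep => x.
  by rewrite -scalerDr addrA scaleN1r subrr add0r.
- move=> x Vx.
  have -> : [tuple chi x *: l i x | i < k] = [tuple l i x | i < k].
    by apply: eq_from_tnth => i; rewrite !tnth_mktuple chi1// scale1r.
  by have [V1x _] := VU1 x Vx; apply: bl; exact: V1U.
- move=> x Vx i j; rewrite chi1// !scale1r; apply: dp.
  by have [] := VU1 x Vx.
Qed.

(** [daddv_pi A B] is the projection onto A along B. If M0 is the graph of a map a : M -> L, then
    pi_M0 u = u + a(u) for u in M, so the value on u, v in M is <a(u), v>. The projections along L
    extend it to E by zero on L. *)
Definition graph_form : form_field E := mkfield (fun x s =>
  if s is [:: u; v] then << daddv_pi (M0 x) (L x) u, daddv_pi (M x) (L x) v >> else 0).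

(** The vectors pi_M0 u - pi_M u and pi_M0 v - pi_M v lie in L, so their pairing is 0; expanding it,
    the isotropy of M and M0 leaves only the two mixed terms. *)
Lemma graph_form_anti x (u v : E x) :
  at_pt graph_form [:: u; v] = - at_pt graph_form [:: v; u].
Proof.
rewrite /at_pt /graph_form /mkfield /=.
have [[eM iM] [eM0 iM0]] := (hLM x, hLM0 x).
have dM w : w = daddv_pi (M x) (L x) w + daddv_pi (L x) (M x) w.
  by rewrite daddv_pi_add ?(addvC (M x)) ?eM ?memvf// capvC.
have dM0 w : w = daddv_pi (M0 x) (L x) w + daddv_pi (L x) (M0 x) w.
  by rewrite daddv_pi_add ?(addvC (M0 x)) ?eM0 ?memvf// capvC.
have LM w : daddv_pi (M0 x) (L x) w - daddv_pi (M x) (L x) w \in L x.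
  have -> : daddv_pi (M0 x) (L x) w - daddv_pi (M x) (L x) w =
            daddv_pi (L x) (M x) w - daddv_pi (L x) (M0 x) w.
    by apply/eqP; rewrite subr_eq addrAC eq_sym subr_eq addrC -dM -dM0.
  by rewrite rpredB ?memv_pi.
have := lagrangian_isotropic hL (LM u) (LM v).
have isoM := lagrangian_isotropic hM (memv_pi (M x) (L x) u) (memv_pi (M x) (L x) v).
have isoM0 := lagrangian_isotropic hM0 (memv_pi (M0 x) (L x) u) (memv_pi (M0 x) (L x) v).
rewrite pairingBl !pairingBr isoM0 isoM (pairingC C (daddv_pi (M x) (L x) u)) => h.
lra.
Qed.

Section Frame.
Variables (V : set X) (k : nat) (l p e : 'I_k -> sec E).
Hypothesis fr : adapted_frame V l p e.

Definition frame_form : form_field E :=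
  2^-1 *: \sum_j wedge_sec C [:: l j; e j].

Let isoL x (u v : E x) : u \in L x -> v \in L x -> << u, v >> = 0.
Proof. exact: lagrangian_isotropic. Qed.

(** Expand pi_M0 u in the frame p + e of M0. The p_j are orthogonal to pi_M v, and e_j does not see
    the L-component of v. *)
Lemma graph_formE x (u v : E x) : V x ->
  at_pt graph_form [:: u; v] = \sum_j << l j x, u >> * << e j x, v >>.
Proof.
move=> Vx; rewrite /at_pt /graph_form /mkfield /=.
have [[eM iM] [eM0 iM0]] := (hLM x, hLM0 x).
have Me j : << e j x, daddv_pi (M x) (L x) v >> = << e j x, v >>.
  rewrite -[in RHS](@daddv_pi_add _ _ (M x) (L x) v); last by rewrite addvC eM memvf.
    by rewrite pairingDr (isoL ((adapted_graph fr j).2 x) (memv_pi _ _ _)) addr0.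
  by rewrite capvC.
have lu j : << daddv_pi (M0 x) (L x) u, l j x >> = << l j x, u >>.
  rewrite -[in RHS](@daddv_pi_add _ _ (M0 x) (L x) u); last by rewrite addvC eM0 memvf.
    by rewrite pairingDr (isoL ((adapted_L fr j).2 x) (memv_pi _ _ _)) addr0 pairingC.
  by rewrite capvC.
rewrite {1}(dual_expansion (p := fun j x => p j x + e j x) hL hLM0 (adapted_basis fr
  Vx) _ _ (memv_pi _ _ _)).
- rewrite pairing_suml; apply: eq_bigr => j _.
  rewrite pairingZl pairingDl (lagrangian_isotropic hM ((adapted_M fr j).2 x) (memv_pi
    _ _ _)).
  by rewrite add0r Me lu.
- by move=> j; exact: (adapted_M0 fr j).2.
- move=> i j; rewrite pairingDr (adapted_dual fr Vx).
  by rewrite (isoL ((adapted_L fr i).2 x) ((adapted_graph fr j).2 x)) addr0.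
Qed.

Lemma gamk_frame2 j : gamk C L 2 (wedge_sec C [:: l j; e j]).
Proof.
apply: (@gamk_wedge_sec _ _ _ _ _ C L [:: l j; e j]) => -[|[|]]// _; first exact:
  (adapted_L fr j).
exact: (adapted_graph fr j).
Qed.

Lemma gam_frame_form : gam C L frame_form.
Proof.
apply: gamZ; apply: gam_sum => j; exact: (gamk_frame2 j).1.
Qed.

(** The tensor sum_j l_j (x) e_j is already skew by [graph_form_anti], so antisymmetrizing it
    doubles it: hence the factor 1/2 in [frame_form]. *)
Lemma graph_form_frame : agree_on V graph_form frame_form.
Proof.
move=> x s Vx; rewrite /frame_form.
have -> : at_pt (2^-1 *: \sum_j wedge_sec C [:: l j; e j]) s =
    2^-1 * \sum_j wedge_seq C [:: l j x; e j x] s.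
  by rewrite -(at_pt_sum (fun j => wedge_sec C [:: l j; e j])).
have [s2|s2] := eqVneq (size s) 2%N; last first.
  rewrite big1 ?mulr0; last first.
    by move=> j _; rewrite wedge_seq_degree//; exact/eqP.
  by case: s s2 => [|u [|v [|w s]]].
case: s s2 => [|u [|v [|w s]]]// _.
under eq_bigr do rewrite wedge_seq2.
rewrite sumrB; have := graph_form_anti u v.
rewrite !graph_formE// => h.
have -> : \sum_(i < k) << l i x, v >> * << e i x, u >> =
  - \sum_j << l j x, u >> * << e j x, v >> by rewrite h opprK.
by rewrite opprK; lra.
Qed.

End Frame.

Lemma gamk_graph_form : gamk C L 2 graph_form.
Proof.
split; last by move=> x [|u [|v [|w s]]].
apply: gam_local => x0; have [V [k [l [p [e [Vx0 fr]]]]]] := adapted_frame_exists x0.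
exists V, (frame_form l e); split=> //; first exact: adapted_open fr.
  exact: gam_frame_form fr.
exact: graph_form_frame fr.
Qed.

End AdaptedFrames.

(** * The Nijenhuis tensor in a frame *)

Section BracketIdentities.
Variables (R : realType) (m : nat) (X : smooth_manifold R m).
Variables (r : nat) (E : vector_bundle X r) (C : courant_algebroid E).
Local Notation "<< u , v >>" := (pairing C u v).

Lemma bracketDl e1 e2 e3 x : smooth_sec e1 -> smooth_sec e2 -> smooth_sec e3 ->
  bracket C (fun y => e1 y + e2 y) e3 x = bracket C e1 e3 x + bracket C e2 e3 x.
Proof.
move=> s1 s2 s3; rewrite -[bracket C e1 e3 x]scale1r -bracketPl//.
congr (bracket C _ e3 x); apply: functional_extensionality_dep => y.
by rewrite scale1r.
Qed.

Lemma bracketDr e1 e2 e3 x : smooth_sec e1 -> smooth_sec e2 -> smooth_sec e3 ->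
  bracket C e1 (fun y => e2 y + e3 y) x = bracket C e1 e2 x + bracket C e1 e3 x.
Proof.
move=> s1 s2 s3; rewrite -[bracket C e1 e2 x]scale1r -bracketPr//.
congr (bracket C e1 _ x); apply: functional_extensionality_dep => y.
by rewrite scale1r.
Qed.

Lemma anchorN x (v : E x) f : smooth f -> anchor C v (fun y => - f y) = - anchor C v f.
Proof.
move=> sf; have [lin _] := anchor_tangent C v.
have := lin (-1) f (fun=> 0) sf (smooth_on_cst 0 openT).
have := lin (-1) (fun=> 0) (fun=> 0) (smooth_on_cst 0 openT) (smooth_on_cst 0 openT).
under eq_fun do rewrite mulr0 addr0.
under [X in _ -> anchor C v X = _ -> _]eq_fun do rewrite mulN1r addr0.
by lra.
Qed.

Lemma anchor0 x f : smooth f -> anchor C (0 : E x) f = 0.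
Proof.
move=> sf; have := anchorP C 1 (0 : E x) 0 sf.
by rewrite scaler0 addr0; lra.
Qed.

Lemma anchor_suml x k (c : 'I_k -> R) (u : 'I_k -> E x) f : smooth f ->
  anchor C (\sum_i c i *: u i) f = \sum_i c i * anchor C (u i) f.
Proof.
move=> sf; elim: (index_enum _) => [|i q IH]; first by rewrite !big_nil anchor0.
by rewrite !big_cons anchorP// IH.
Qed.

Lemma pairing_bracketC e1 e2 x (v : E x) : smooth_sec e1 -> smooth_sec e2 ->
  << bracket C e1 e2 x, v >> =
  - << bracket C e2 e1 x, v >> + anchor C v (fun y => << e1 y, e2 y >>).
Proof. by move=> s1 s2; rewrite -bracket_symmetrized// pairingDl; ring. Qed.

(** In (A3) the right-hand side is the derivative of <e1, e2>, which is identically zero. *)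
Lemma pairing_bracketC_isotropic (N : forall x, {vspace E x}) e1 e2 x (v : E x) :
  lagrangian C N -> sec_in N e1 -> sec_in N e2 ->
  << bracket C e1 e2 x, v >> = - << bracket C e2 e1 x, v >>.
Proof.
move=> hN [s1 N1] [s2 N2]; rewrite pairing_bracketC//.
suff -> : (fun y => << e1 y, e2 y >>) = (fun=> 0).
  rewrite (tangent_vector_locally_cst (anchor_tangent C v) _ openT I (c := 0)) ?addr0//.
  by apply: smooth_on_cst; exact: openT.
by apply/funext => y; rewrite (lagrangian_isotropic hN).
Qed.

End BracketIdentities.

(** * Contractions of brackets in an adapted frame *)

Section FrameComputations.
Variables (R : realType) (m : nat) (X : smooth_manifold R m).
Variables (r : nat) (E : vector_bundle X r) (C : courant_algebroid E).
Local Notation "<< u , v >>" := (pairing C u v).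
Variables (L M M0 : forall x, {vspace E x}).
Hypotheses (dL : dirac_structure C L) (hM : lagrangian C M) (hLM : complementary L M).
Hypotheses (hM0 : dirac_structure C M0) (hLM0 : complementary L M0).
Variables (V : set X) (k : nat) (l p e : 'I_k -> sec E).
Hypothesis fr : adapted_frame C L M M0 V l p e.
Variable x : X.
Hypothesis Vx : V x.
Local Notation "'brk' s t" := (bracket C s t x) (at level 10, s at level 9, t at level 9).
Local Notation rho := (anchor C).
Local Notation eta a b := (fun y => << e a y, p b y >>).

Let hL : lagrangian C L. Proof. exact: dL.1. Qed.
Let sl i : smooth_sec (l i). Proof. exact: (adapted_L fr i).1. Qed.
Let sp i : smooth_sec (p i). Proof. exact: (adapted_M fr i).1. Qed.
Let se i : smooth_sec (e i). Proof. exact: (adapted_graph fr i).1. Qed.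
Let seta a b : smooth (eta a b). Proof. exact: pairing_smooth. Qed.

Lemma eta_anti a b y : << e a y, p b y >> = - << e b y, p a y >>.
Proof.
have := lagrangian_isotropic hM0.1 ((adapted_M0 fr a).2 y) ((adapted_M0 fr b).2 y).
rewrite !pairingDl !pairingDr (lagrangian_isotropic hM ((adapted_M fr a).2 y)
  ((adapted_M fr b).2 y)).
rewrite (lagrangian_isotropic hL ((adapted_graph fr a).2 y) ((adapted_graph fr b).2 y)).
by rewrite (pairingC C (p a y)); lra.
Qed.

Lemma rho_eta_anti (v : E x) a b : rho v (eta a b) = - rho v (eta b a).
Proof. by rewrite -anchorN//; congr (rho v _); apply/funext => y; exact: eta_anti. Qed.

Lemma rho_eta_C (v : E x) a b : rho v (fun y => << p a y, e b y >>) = rho v (eta b a).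
Proof. by congr (rho v _); apply/funext => y; exact: pairingC. Qed.

Lemma rho_dual (v : E x) j a : rho v (fun y => << l j y, p a y >>) = 0.
Proof.
apply: (tangent_vector_locally_cst (anchor_tangent C v) _ (adapted_open fr) Vx).
  exact: pairing_smooth.
by move=> y Vy; exact: (adapted_dual fr Vy).
Qed.

Lemma sum_dual (F : 'I_k -> R) a : \sum_j << l j x, p a x >> * F j = F a.
Proof.
rewrite (bigD1 a)//= (adapted_dual fr Vx) eqxx mul1r big1 ?addr0// => j ja.
by rewrite (adapted_dual fr Vx) (negbTE ja) mul0r.
Qed.

Lemma graph_expansion c : e c x = - \sum_j << e j x, p c x >> *: l j x.
Proof.
rewrite [LHS](basis_expansion hL hM hLM (adapted_basis fr Vx) (fun i => (adapted_M fr
  i).2 x) (adapted_dual fr Vx) ((adapted_graph fr c).2 x)).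
rewrite -sumrN; apply: eq_bigr => j _.
by rewrite eta_anti scaleNr.
Qed.

Lemma sum_eta c (v : E x) : \sum_j << l j x, v >> * << e j x, p c x >> = - << e c x, v >>.
Proof.
rewrite graph_expansion pairingNl pairing_suml opprK.
by apply: eq_bigr => j _; rewrite pairingZl mulrC.
Qed.

Lemma sum_bracket_le a b c :
  \sum_j << brk (l j) (e c), p a x >> * << e j x, p b x >> =
  - << brk (e b) (e c), p a x >> - rho (e c x) (eta b a).
Proof.
have -> : \sum_j << brk (l j) (e c), p a x >> * << e j x, p b x >> =
          \sum_j << l j x, brk (e c) (p a) >> * << e j x, p b x >>.
  apply: eq_bigr => j _; congr (_ * _).
  rewrite (pairing_bracketC_isotropic _ hL (adapted_L fr j) (adapted_graph fr c)).
  have := bracket_pairing C (se c) (sl j) (sp a) x; rewrite rho_dual.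
  by lra.
rewrite sum_eta.
rewrite (pairing_bracketC_isotropic _ hL (adapted_graph fr b) (adapted_graph fr c)).
by have := bracket_pairing C (se c) (se b) (sp a) x; lra.
Qed.

(** (A2) takes the bracket off l_j, and the sum over j collapses to a pairing of e_c with
    [l_i, p_a]; (A2) again gives [l_i, e_c] and the derivative along l_i. The former is summed by
    [sum_bracket_le]; the latter collapses because the anchor is linear over functions. *)
Lemma sum_bracket_ll a b c :
  \sum_i \sum_j << brk (l i) (l j), p a x >> * (<< e i x, p b x >> * << e j x, p c x >>) =
  << brk (e b) (e c), p a x >> - rho (e b x) (eta c a) + rho (e c x) (eta b a).
Proof.
have -> : \sum_i \sum_j << brk (l i) (l j), p a x >> * (<< e i x, p b x >> * << e j x,
  p c x >>) =
  \sum_i (<< e i x, p b x >> * rho (l i x) (eta c a) -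
     << brk (l i) (e c), p a x >> * << e i x, p b x >>).
  apply: eq_bigr => i _.
  have -> : << e i x, p b x >> * rho (l i x) (eta c a) -
      << brk (l i) (e c), p a x >> * << e i x, p b x >> =
      - << e i x, p b x >> * \sum_j << l j x, brk (l i) (p a) >> * << e j x, p c x >>.
    rewrite sum_eta; have := bracket_pairing C (sl i) (se c) (sp a) x.
    by move=> ->; ring.
  rewrite mulr_sumr; apply: eq_bigr => j _.
  have := bracket_pairing C (sl i) (sl j) (sp a) x; rewrite rho_dual => h.
  have -> : << brk (l i) (l j), p a x >> = - << l j x, brk (l i) (p a) >> by lra.
  by ring.
rewrite sumrB sum_bracket_le -anchor_suml//.
have -> : \sum_i << e i x, p b x >> *: l i x = -1 *: e b x + 0.
  by rewrite addr0 scaleN1r [in RHS]graph_expansion opprK.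
by rewrite anchorP// anchor0//; ring.
Qed.

Lemma sum_bracket_dual (v : 'I_k -> 'I_k -> R) b c :
  \sum_i \sum_j v i j * (<< l i x, p b x >> * << l j x, p c x >>) = v b c.
Proof.
transitivity (\sum_i << l i x, p b x >> * \sum_j << l j x, p c x >> * v i j).
  by apply: eq_bigr => i _; rewrite mulr_sumr; apply: eq_bigr => j _; ring.
by rewrite sum_dual sum_dual.
Qed.

(** The tensor u (x) v (x) w before alternation. Contractions over the frame are carried out on it,
    and [sum_wedge_seq3] alternates the results. *)
Definition wedge_eval (u v w : E x) a b c :=
  << u, p a x >> * (<< v, p b x >> * << w, p c x >>).

Lemma wedge_seq3_alt (u v w : E x) a b c :
  wedge_seq C [:: u; v; w] [:: p a x; p b x; p c x] =
  wedge_eval u v w a b c - wedge_eval u v w a c b -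
  wedge_eval u v w b a c + wedge_eval u v w b c a +
  wedge_eval u v w c a b - wedge_eval u v w c b a.
Proof. by rewrite wedge_seq3 /wedge_eval; ring. Qed.

Lemma sum_wedge_seq3 (u v w : 'I_k -> 'I_k -> E x) (S : 'I_k -> 'I_k -> 'I_k -> R) a b c :
  (forall a b c, \sum_i \sum_j wedge_eval (u i j) (v i j) (w i j) a b c = S a b c) ->
  \sum_i \sum_j wedge_seq C [:: u i j; v i j; w i j] [:: p a x; p b x; p c x] =
  S a b c - S a c b - S b a c + S b c a + S c a b - S c b a.
Proof.
move=> SE; rewrite -!SE.
rewrite -!(big_split, sumrB) /=.
apply: eq_bigr => i _; rewrite -!(big_split, sumrB) /=.
by apply: eq_bigr => j _; exact: wedge_seq3_alt.
Qed.

(* The quadratic part of the Nijenhuis tensor of M0 in the frame p + e. *)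
Definition schouten_eval a b c : R :=
  << brk (e b) (e c), p a x >> + << brk (e c) (e a), p b x >> +
  << brk (e a) (e b), p c x >> - rho (e a x) (eta b c) - rho (e b x) (eta c a) -
  rho (e c x) (eta a b).

(** Each of the four families yields <[e_b, e_c], p_a> with coefficient 1 once its sign is included,
    and alternation in b and c doubles it: 4 * 2 = 8. The anchor terms reach the same factor through
    the skewness of [eta]. *)
Lemma sum_schouten a b c :
  \sum_i \sum_j (
     wedge_seq C [:: brk (l i) (l j); e i x; e j x] [:: p a x; p b x; p c x] -
     wedge_seq C [:: brk (l i) (e j); e i x; l j x] [:: p a x; p b x; p c x] -
     wedge_seq C [:: brk (e i) (l j); l i x; e j x] [:: p a x; p b x; p c x] +
     wedge_seq C [:: brk (e i) (e j); l i x; l j x] [:: p a x; p b x; p c x]) =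
  8%:R * schouten_eval a b c.
Proof.
have anti u v : forall w : E x, << brk (e u) (e v), w >> = - << brk (e v) (e u), w >>.
  by move=> w; exact: pairing_bracketC_isotropic hL (adapted_graph fr u) (adapted_graph
    fr v).
under eq_bigr do rewrite big_split !sumrB /=.
rewrite big_split !sumrB /=.
rewrite (sum_wedge_seq3 (S := fun a b c =>
  << brk (e b) (e c), p a x >> - rho (e b x) (eta c a) + rho (e c x) (eta b a))); last
    first.
  exact: sum_bracket_ll.
rewrite (sum_wedge_seq3 (S := fun a b c =>
  - << brk (e b) (e c), p a x >> - rho (e c x) (eta b a))); last first.
  move=> a' b' c'; rewrite -sum_bracket_le.
  apply: eq_bigr => i _; rewrite -(sum_dual (fun j => << brk (l i) (e j), p a' x >>))
    mulr_suml.
  by apply: eq_bigr => j _; rewrite /wedge_eval; ring.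
rewrite (sum_wedge_seq3 (S := fun a b c =>
  - << brk (e b) (e c), p a x >> + rho (e b x) (eta c a))); last first.
  (* Skewness of the bracket on L reduces this family to the previous contraction with the two
     factors interchanged. *)
  move=> a' b' c'; transitivity (- \sum_j << brk (l j) (e b'), p a' x >> * << e j x, p
    c' x >>).
    rewrite -sumrN exchange_big /=; apply: eq_bigr => j _.
    rewrite (pairing_bracketC_isotropic _ hL (adapted_L fr j) (adapted_graph fr b'))
      mulNr opprK.
    rewrite -(sum_dual (fun i => << brk (e i) (l j), p a' x >>)) mulr_suml.
    by apply: eq_bigr => i _; rewrite /wedge_eval; ring.
  by rewrite sum_bracket_le (anti c' b'); ring.
rewrite (sum_wedge_seq3 (S := fun a b c => << brk (e b) (e c), p a x >>)); last first.
  by move=> a' b' c'; exact: (sum_bracket_dual (fun i j => << brk (e i) (e j), p a' x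
    >>)).
rewrite /schouten_eval.
rewrite (anti c b) (anti a c) (anti b a).
rewrite !(rho_eta_anti _ c b) !(rho_eta_anti _ a c) !(rho_eta_anti _ b a).
by ring.
Qed.

(* The linear part of the Nijenhuis tensor of M0 in the frame p + e. *)
Definition dM_eval a b c : R :=
  rho (p a x) (eta b c) - rho (p b x) (eta a c) + rho (p c x) (eta a b) +
  << e c x, brk (p a) (p b) >> - << e b x, brk (p a) (p c) >> +
  << e a x, brk (p b) (p c) >>.

(** M0 is closed under the bracket and isotropic, so <[p_a + e_a, p_b + e_b], p_c + e_c> = 0. Of its
    eight terms, the three with one e give [dM_eval] and the three with two e give [schouten_eval],
    by (A2) and (A3). *)
Lemma nijenhuis_graph a b c :
  << brk (p a) (p b), p c x >> + dM_eval a b c + schouten_eval a b c = 0.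
Proof.
have := lagrangian_isotropic hM0.1 (hM0.2 _ _ (adapted_M0 fr a) (adapted_M0 fr b) x)
  ((adapted_M0 fr c).2 x).
have sD i : smooth_sec (fun y => p i y + e i y) by exact: (adapted_M0 fr i).1.
rewrite bracketDl// !bracketDr// !pairingDl !pairingDr.
have := bracket_pairing C (sp a) (se b) (sp c) x.
have := pairing_bracketC C (p c x) (se a) (sp b).
have := bracket_pairing C (sp b) (se a) (sp c) x.
have := pairing_bracketC C (e c x) (sp a) (se b).
have := bracket_pairing C (se b) (sp a) (se c) x.
have := bracket_pairing C (se a) (sp b) (se c) x.
rewrite /dM_eval /schouten_eval !rho_eta_C.
rewrite (pairingC C (e b x) (brk (p a) (p c))) (pairingC C (e a x) (brk (p b) (p c))).
rewrite (pairingC C (e c x) (brk (p a) (p b))).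
rewrite (pairingC C (p a x) (brk (e b) (e c))) (pairingC C (p b x) (brk (e a) (e c))).
rewrite (pairing_bracketC_isotropic (p b x) hL (adapted_graph fr a) (adapted_graph fr c)).
have -> : << bracket C (e a) (e b) x, e c x >> = 0.
  apply: lagrangian_isotropic hL _ ((adapted_graph fr c).2 x).
  exact: dL.2 (adapted_graph fr a) (adapted_graph fr b) x.
rewrite !(rho_eta_anti _ c b) !(rho_eta_anti _ a c) !(rho_eta_anti _ b a).
by lra.
Qed.

End FrameComputations.

(** * The obstruction class *)

Section Abelianization.
Variables (R : realType) (m : nat) (X : smooth_manifold R m).
Variables (r : nat) (E : vector_bundle X r) (C : courant_algebroid E).
Variable L : forall x, {vspace E x}.
Variables br : form_field E -> form_field E -> form_field E.
Variable d : form_field E -> form_field E.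
Hypothesis hbr : is_schouten C L br.
Hypothesis d_linear : forall (c : R) a b, gam C L a -> gam C L b ->
  d (c *: a + b) = c *: d a + d b.

Lemma gamkP k (c : R) a b : gamk C L k a -> gamk C L k b -> gamk C L k (c *: a + b).
Proof.
move=> [ga a0] [gb b0]; split; first exact: gamP.
move=> x s sk; have -> : at_pt (c *: a + b) s = c * at_pt a s + at_pt b s by [].
by rewrite a0// b0// mulr0 addr0.
Qed.

Lemma commutatorP (c : R) w w' : in_commutator C L br w -> in_commutator C L br w' ->
  in_commutator C L br (c *: w + w').
Proof.
move=> [k [a [b [gab ->]]]] [k' [a' [b' [gab' ->]]]].
exists (k + k')%N, (fun i => match fintype.split i with inl j => c *: a j | inr j => a'
  j end),
  (fun i => match fintype.split i with inl j => b j | inr j => b' j end); split.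
  move=> i; case: (fintype.split i) => j; last exact: gab'.
  by have [ga gb] := gab j; split=> //; exact: gamZ.
rewrite big_split_ord /= scaler_sumr; congr (_ + _); apply: eq_bigr => i _.
  have -> := unsplitK (inl i : 'I_k + 'I_k')%type; have [ga gb] := gab i.
  have := schouten_linl hbr c ga (gam0 C L) gb; rewrite addr0 => ->.
  have := schouten_linl hbr 1 (gam0 C L) (gam0 C L) gb; rewrite !scale1r addr0.
  by move=> /eqP; rewrite -subr_eq subrr => /eqP <-; rewrite addr0.
by have -> := unsplitK (inr i : 'I_k + 'I_k')%type.
Qed.

(** The closedness condition involves only the representative w', so the two sets differ only in the
    primitive, which is shifted by b0. *)
Lemma coh_class_exact k w b0 : gamk C L k b0 -> in_commutator C L br (w - d b0) ->
  coh_class C L br d k w = coh_class C L br d k 0.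
Proof.
move=> gb0 wb0; apply/seteqP; split=> w' [gw' dw' [b gb wb]]; split=> //.
  exists (1 *: b + b0); first exact: gamkP.
  rewrite /eq_ab (d_linear _ gb.1 gb0.1) scale1r add0r.
  have := commutatorP 1 wb wb0; rewrite scale1r; congr (in_commutator _ _ _ _).
  by rewrite opprD -addrA addrACA addNr add0r -opprD.
exists (-1 *: b0 + b); first exact: gamkP.
rewrite /eq_ab (d_linear _ gb0.1 gb.1) scaleN1r.
have := commutatorP (-1) wb0 wb; rewrite scaleN1r add0r; congr (in_commutator _ _ _ _).
by rewrite !opprD !opprK addrC -addrA; congr (_ + _); rewrite addrCA [- d b + _]addrC.
Qed.

Lemma linear0 : d 0 = 0.
Proof.
have := d_linear 1 (gam0 C L) (gam0 C L); rewrite !scale1r addr0.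
by move=> /eqP; rewrite -subr_eq subrr => /eqP <-.
Qed.

(** Only linearity on [gam] is assumed of d: this applies to d_M and to the Schouten bracket in
    either argument. *)
Lemma linear_sum k (a : 'I_k -> form_field E) : (forall i, gam C L (a i)) ->
  d (\sum_i a i) = \sum_i d (a i).
Proof.
move=> ga; suff [] : d (\sum_i a i) = \sum_i d (a i) /\ gam C L (\sum_i a i) by [].
apply: (big_rec2 (fun u v => d u = v /\ gam C L u)).
  by split; [exact: linear0|exact: gam0].
move=> i u v _ [<- gu]; split; last exact: gamD.
by have := d_linear 1 (ga i) gu; rewrite !scale1r.
Qed.

Lemma linear_scale (c : R) a : gam C L a -> d (c *: a) = c *: d a.
Proof. by move=> ga; have := d_linear c ga (gam0 C L); rewrite linear0 !addr0. Qed.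

End Abelianization.

Lemma multilinear_mod_frame (R : realType) (m : nat) (X : smooth_manifold R m)
    (r : nat) (E : vector_bundle X r) (L : forall x, {vspace E x}) (x : X) k
    (p : 'I_k -> sec E) (w : seq (E x) -> R) s1 s2 :
  (forall u, exists (v : E x) (c : 'I_k -> R), v \in L x /\ u = v + \sum_j c j *: p j
    x) ->
  multilinear_mod L w -> (forall a, w (s1 ++ p a x :: s2) = 0) ->
  forall u, w (s1 ++ u :: s2) = 0.
Proof.
move=> dec [wD w0] wp u; have [v [c [Lv ->]]] := dec u.
rewrite -[v]scale1r wD w0// mulr0 add0r.
elim: (index_enum _) => [|i q IH]; first by rewrite big_nil w0// mem0v.
by rewrite big_cons wD wp IH mulr0 addr0.
Qed.

(** * Evaluation of d_M eps and [eps, eps], and the Maurer-Cartan equation *)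

Section Obstruction.
Variables (R : realType) (m : nat) (X : smooth_manifold R m).
Variables (r : nat) (E : vector_bundle X r) (C : courant_algebroid E).
Local Notation "<< u , v >>" := (pairing C u v).
Variables (L M M0 : forall x, {vspace E x}).
Hypotheses (dL : dirac_structure C L) (hM : lagrangian C M) (hLM : complementary L M).
Hypotheses (hM0 : dirac_structure C M0) (hLM0 : complementary L M0).
Variables br : form_field E -> form_field E -> form_field E.
Variable d : form_field E -> form_field E.
Hypotheses (hbr : is_schouten C L br) (hd : is_dM C L M d).

Let isoL x (u v : E x) : u \in L x -> v \in L x -> << u, v >> = 0.
Proof. exact: lagrangian_isotropic dL.1. Qed.

(** Locality is derived from the derivation rule: applied to chi (w - w') = 0, with chi = 1 near x,
    it leaves d(w - w') = 0 at x, because w - w' vanishes there. *)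
Lemma dM_local V w w' x (s : seq (E x)) : open V -> V x -> gam C L w -> gam C L w' ->
  agree_on V w w' -> at_pt (d w) s = at_pt (d w') s.
Proof.
move=> oV Vx gw gw' ww'; have [chi [V' [W [schi [_ V'x] chi1 _ [chi0 UW]]]]] :=
  smooth_bump oV Vx.
have gz : gam C L (-1 *: w' + w) by exact: gamP.
have := dM_derivation hd (gamk_fn C L schi) gz.
have -> : fwedge (fn chi) (-1 *: w' + w) = 0.
  apply/funext => -[y t]; rewrite -[LHS]/(at_pt (fwedge (fn chi) (-1 *: w' + w)) t)
    fwedge_fn.
  have [Vy|Wy] := UW y; last by rewrite chi0// mul0r.
  have -> : at_pt (-1 *: w' + w) t = -1 * at_pt w' t + at_pt w t by [].
  by rewrite ww'// mulN1r addrC subrr mulr0.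
rewrite (linear0 (dM_linear hd)) => /(congr1 (fun z : form_field E => at_pt z s)).
have -> : at_pt (fwedge (d (fn chi)) (-1 *: w' + w) +
    (-1) ^+ 0 *: fwedge (fn chi) (d (-1 *: w' + w))) s =
  at_pt (fwedge (d (fn chi)) (-1 *: w' + w)) s +
  1 * at_pt (fwedge (fn chi) (d (-1 *: w' + w))) s by [].
have -> : at_pt (fwedge (d (fn chi)) (-1 *: w' + w)) s = 0.
  apply: wedge_prod0r => t; have -> : at_pt (-1 *: w' + w) t = -1 * at_pt w' t + at_pt
    w t by [].
  by rewrite ww'// mulN1r addrC subrr.
rewrite fwedge_fn chi1// !mul1r add0r (dM_linear hd)//.
have -> : at_pt (-1 *: d w' + d w) s = -1 * at_pt (d w') s + at_pt (d w) s by [].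
have -> : at_pt (0 : form_field E) s = 0 by [].
by lra.
Qed.

Section Frame.
Variables (V : set X) (k : nat) (l p e : 'I_k -> sec E).
Hypothesis fr : adapted_frame C L M M0 V l p e.
Variable x : X.
Hypothesis Vx : V x.

Lemma gamk_wedge1 s : sec_in L s -> gamk C L 1 (wedge_sec C [:: s]).
Proof. by move=> Ls; apply: (@gamk_wedge_sec _ _ _ _ _ C L [:: s]) => -[|]. Qed.

Lemma at_pt_wedge1 s : at_pt (wedge_sec C [:: s]) (x := x) = covector C (s x).
Proof. by apply/funext => t; exact: wedge_seq1. Qed.

Lemma wedge_sec2 s t : wedge_sec C [:: s; t] = fwedge (wedge_sec C [:: s]) (wedge_sec C
  [:: t]).
Proof.
apply/funext => -[y q].
rewrite -[RHS]/(wedge_prod (at_pt (wedge_sec C [:: s]) (x := y)) (wedge_seq C [:: t y])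
  q).
by congr (wedge_prod _ _ _); apply/funext => u; rewrite -[RHS]/(wedge_seq C [:: s y] u)
  wedge_seq1.
Qed.

(** In d(l_j /\ e_j) = dl_j /\ e_j - l_j /\ de_j the first product gives only bracket terms, as
    <l_j, p_a> is locally constant. The second gives them again, together with each anchor term
    twice by skewness; so every term occurs twice and the 1/2 of eps cancels. *)
Lemma dM_frame_form a b c :
  at_pt (d (frame_form C l e)) [:: p a x; p b x; p c x] = dM_eval C p e x a b c.
Proof.
have gw j : gam C L (wedge_sec C [:: l j; e j]) by exact: (gamk_frame2 fr j).1.
rewrite /frame_form (linear_scale (dM_linear hd)); last exact: gam_sum.
rewrite (linear_sum (dM_linear hd))//.
have -> : at_pt (2^-1 *: \sum_j d (wedge_sec C [:: l j; e j])) [:: p a x; p b x; p c x] =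
    2^-1 * \sum_j at_pt (d (wedge_sec C [:: l j; e j])) [:: p a x; p b x; p c x].
  by rewrite -(at_pt_sum (fun j => d (wedge_sec C [:: l j; e j]))).
pose B a b := bracket C (p a) (p b) x.
pose dE j a b := anchor C (p a x) (fun y => << e j y, p b y >>) -
  anchor C (p b x) (fun y => << e j y, p a y >>) - << e j x, B a b >>.
have dl j a' b' : at_pt (d (wedge_sec C [:: l j])) [:: p a' x; p b' x] = - << l j x, B
  a' b' >>.
  rewrite (dM_sec hd (adapted_L fr j) (adapted_M fr a') (adapted_M fr b')).
  by rewrite !(rho_dual fr Vx) subrr sub0r.
have de j a' b' : at_pt (d (wedge_sec C [:: e j])) [:: p a' x; p b' x] = dE j a' b'.
  exact: (dM_sec hd (adapted_graph fr j) (adapted_M fr a') (adapted_M fr b')).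
have -> : \sum_j at_pt (d (wedge_sec C [:: l j; e j])) [:: p a x; p b x; p c x] =
   (\sum_j << l j x, B a c >> * << e j x, p b x >> -
    \sum_j << l j x, B a b >> * << e j x, p c x >> -
    \sum_j << l j x, B b c >> * << e j x, p a x >>) -
   (\sum_j << l j x, p a x >> * dE j b c - \sum_j << l j x, p b x >> * dE j a c +
    \sum_j << l j x, p c x >> * dE j a b).
  rewrite -!(sumrB, big_split) /=; apply: eq_bigr => j _.
  rewrite wedge_sec2 (dM_derivation hd (gamk_wedge1 (adapted_L fr j)) (gamk_wedge1
    (adapted_graph fr j)).1).
  rewrite expr1.
  have -> : at_pt (fwedge (d (wedge_sec C [:: l j])) (wedge_sec C [:: e j]) +
      -1 *: fwedge (wedge_sec C [:: l j]) (d (wedge_sec C [:: e j]))) [:: p a x; p b x;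
        p c x] =
    wedge_prod (at_pt (d (wedge_sec C [:: l j])) (x := x)) (at_pt (wedge_sec C [:: e
      j]) (x := x)) [:: p a x; p b x; p c x] +
    -1 * wedge_prod (at_pt (wedge_sec C [:: l j]) (x := x)) (at_pt (d (wedge_sec C [::
      e j])) (x := x)) [:: p a x; p b x; p c x] by [].
  rewrite !at_pt_wedge1 wedge_prod_covector_form2 wedge_prod_form2_covector; last first.
    by move=> s s2; apply: (dM_degree hd (gamk_wedge1 (adapted_L fr j))).2.
  by rewrite !dl !de; ring.
rewrite !(sum_dual fr Vx) !(sum_eta dL hM hLM hM0 fr Vx) /dE /dM_eval -/(B a b) -/(B a
  c) -/(B b c).
rewrite !(rho_eta_anti dL hM hM0 fr _ c b) !(rho_eta_anti dL hM hM0 fr _ c a)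
  !(rho_eta_anti dL hM hM0 fr _ b a).
by lra.
Qed.

Lemma schouten_wedge2 s t s' t' : sec_in L s -> sec_in L t -> sec_in L s' -> sec_in L
  t' ->
  br (wedge_sec C [:: s; t]) (wedge_sec C [:: s'; t']) =
  wedge_sec C [:: bracket C s s'; t; t'] - wedge_sec C [:: bracket C s t'; t; s'] -
  wedge_sec C [:: bracket C t s'; s; t'] + wedge_sec C [:: bracket C t t'; s; s'].
Proof.
move=> Ls Lt Ls' Lt'.
pose u := fun i : 'I_2 => nth s [:: s; t] i; pose u' := fun i : 'I_2 => nth s [:: s';
  t'] i.
have Lu i : sec_in L (u i) by case: i => -[|[|]].
have Lu' i : sec_in L (u' i) by case: i => -[|[|]].
have := schouten_wedge hbr (isT : (0 < 2)%N) (isT : (0 < 2)%N) Lu Lu'.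
rewrite !big_ord_recl !big_ord0 !enum_ordSl !enum_ord0 /= !addr0.
rewrite /bump /= !addn0 expr0 expr1 expr2 mulN1r opprK !scale1r !scaleN1r.
by move=> ->; rewrite !addrA.
Qed.


Lemma schouten_suml n (a : 'I_n -> form_field E) w : (forall i, gam C L (a i)) -> gam C
  L w ->
  br (\sum_i a i) w = \sum_i br (a i) w.
Proof.
move=> ga gw; apply: (linear_sum (d := br^~ w) _ ga) => c u v gu gv.
exact: (schouten_linl hbr).
Qed.

Lemma schouten_sumr n (a : 'I_n -> form_field E) w : (forall i, gam C L (a i)) -> gam C
  L w ->
  br w (\sum_i a i) = \sum_i br w (a i).
Proof.
move=> ga gw; apply: (linear_sum (d := br w) _ ga) => c u v gu gv.
exact: (schouten_linr hbr).
Qed.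

Lemma schouten_frame_form : br (frame_form C l e) (frame_form C l e) = 4^-1 *:
  \sum_i \sum_j (wedge_sec C [:: bracket C (l i) (l j); e i; e j] -
    wedge_sec C [:: bracket C (l i) (e j); e i; l j] -
    wedge_sec C [:: bracket C (e i) (l j); l i; e j] +
    wedge_sec C [:: bracket C (e i) (e j); l i; l j]).
Proof.
have gw j : gam C L (wedge_sec C [:: l j; e j]) by exact: (gamk_frame2 fr j).1.
have gs : gam C L (\sum_j wedge_sec C [:: l j; e j]) by exact: gam_sum.
have gf : gam C L (frame_form C l e) by exact: gam_frame_form fr.
rewrite {1}/frame_form.
rewrite (linear_scale (d := br^~ (frame_form C l e)) (fun c u v gu gv => schouten_linl
  hbr c gu gv gf))//.
rewrite /frame_form (linear_scale (fun c u v gu gv => schouten_linr hbr c gs gu gv))//.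
rewrite scalerA; congr (_ *: _); first by field.
rewrite schouten_suml//; apply: eq_bigr => i _.
rewrite schouten_sumr//; apply: eq_bigr => j _.
by apply: schouten_wedge2; [exact: (adapted_L fr)|exact: (adapted_graph fr)|exact:
  (adapted_L fr)|exact: (adapted_graph fr)].
Qed.

Lemma schouten_graph_form s :
  at_pt (br (graph_form C L M M0) (graph_form C L M M0)) s = 4^-1 *
  \sum_i \sum_j (wedge_seq C [:: bracket C (l i) (l j) x; e i x; e j x] s -
    wedge_seq C [:: bracket C (l i) (e j) x; e i x; l j x] s -
    wedge_seq C [:: bracket C (e i) (l j) x; l i x; e j x] s +
    wedge_seq C [:: bracket C (e i) (e j) x; l i x; l j x] s).
Proof.
have gg := (gamk_graph_form dL.1 hM hLM hM0.1 hLM0).1.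
have gf : gam C L (frame_form C l e) by exact: gam_frame_form fr.
have gE := graph_form_frame dL.1 hM hLM hM0.1 hLM0 fr.
have oV := adapted_open fr.
(* The expression of eps in the frame holds on V only; locality replaces one argument at a time. *)
rewrite (schouten_locl hbr oV gg gf gg gE _ Vx) (schouten_locr hbr oV gf gg gf gE _ Vx).
rewrite schouten_frame_form.
pose T i j : form_field E := wedge_sec C [:: bracket C (l i) (l j); e i; e j] -
    wedge_sec C [:: bracket C (l i) (e j); e i; l j] -
    wedge_sec C [:: bracket C (e i) (l j); l i; e j] +
    wedge_sec C [:: bracket C (e i) (e j); l i; l j].
rewrite -[LHS]/(4^-1 * at_pt (\sum_i \sum_j T i j) s) (at_pt_sum (fun i => \sum_j T i j)).
by congr (_ * _); apply: eq_bigr => i _; rewrite (at_pt_sum (T i)).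
Qed.

Lemma frame_decomposition (u : E x) : exists (v : E x) (c : 'I_k -> R),
  v \in L x /\ u = v + \sum_j c j *: p j x.
Proof.
have [eM iM] := hLM x.
exists (daddv_pi (L x) (M x) u), (fun j => << daddv_pi (M x) (L x) u, l j x >>); split.
  exact: memv_pi.
rewrite -(dual_expansion dL.1 hLM (adapted_basis fr Vx) (fun i => (adapted_M fr i).2 x)
  (adapted_dual fr Vx) (memv_pi _ _ _)).
by rewrite daddv_pi_add// eM memvf.
Qed.

End Frame.

Variable N : form_field E.
Hypothesis hN : is_nijenhuis C L M N.

Lemma nijenhuis_maurer_cartan :
  N + d (graph_form C L M M0) +
    2^-1 *: br (graph_form C L M M0) (graph_form C L M M0) = 0.
Proof.
set g := graph_form C L M M0.
have gg : gamk C L 2 g := gamk_graph_form dL.1 hM hLM hM0.1 hLM0.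
have gdg := dM_degree hd gg.
set F := N + d g + _.
have gF : gam C L F.
  by apply: gamD; [apply: gamD; [exact: hN.1.1|exact: gdg.1]|apply: gamZ; exact:
    (schouten_gam hbr gg.1 gg.1)].
have FE x (s : seq (E x)) : at_pt F s = at_pt N s + at_pt (d g) s + 2^-1 * at_pt (br g
  g) s by [].
apply/funext => -[x s]; rewrite -[LHS]/(at_pt F s).
have [V [k [l [p [e [Vx fr]]]]]] := adapted_frame_exists dL.1 hM hLM hM0.1 hLM0 x.
(* Outside degree 3, N and d g vanish by their grading, and [g, g] because its frame expression
   consists of products of three vectors. *)
have [s3|s3] := eqVneq (size s) 3; last first.
  rewrite FE hN.1.2; last exact/eqP.
  rewrite gdg.2; last exact/eqP.
  rewrite (schouten_graph_form fr Vx) big1 ?mulr0 ?addr0// => i _.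
  by rewrite big1// => j _; rewrite !wedge_seq_degree ?subr0 ?addr0//; exact/eqP.
have mF := multilinear_mod_multivector isoL (gF.1 x).
case: s s3 => [|u [|v [|w [|? ?]]]]// _.
(* The left-hand side is multilinear and vanishes on L, so each argument in turn may be taken in the
   frame p. *)
have red := multilinear_mod_frame (frame_decomposition fr Vx) mF.
apply: (red [::] [:: v; w]) => a; apply: (red [:: p a x] [:: w]) => b.
apply: (red [:: p a x; p b x] [::]) => c /=.
rewrite FE (hN.2 _ _ _ (adapted_M fr a) (adapted_M fr b) (adapted_M fr c)).
have gE := graph_form_frame dL.1 hM hLM hM0.1 hLM0 fr.
rewrite (dM_local _ (adapted_open fr) Vx gg.1 (gam_frame_form fr) gE).
rewrite (dM_frame_form fr Vx) (schouten_graph_form fr Vx) (sum_schouten dL hM hLM hM0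
  fr Vx).
have := nijenhuis_graph dL hM hM0 fr x a b c.
by lra.
Qed.

End Obstruction.

Theorem theorem4p9 (R : realType) (m n r : nat) (X : smooth_manifold R m)
    (E : vector_bundle X r) (C : courant_algebroid E)
    (L : forall x, {vspace E x})
    (hsig : has_signature C n n)
    (hL : dirac_structure C L)
    (hcompl : exists M0, dirac_structure C M0 /\ complementary L M0)
    (schouten : form_field E -> form_field E -> form_field E)
    (hschouten : is_schouten C L schouten)
    (M : forall x, {vspace E x})
    (hM : lagrangian C M) (hLM : complementary L M)
    (dM : form_field E -> form_field E) (hdM : is_dM C L M dM)
    (NM : form_field E) (hNM : is_nijenhuis C L M NM) :
  coh_class C L schouten dM 2 NM = coh_class C L schouten dM 2 0.
Proof.
have [M0 [hM0 hLM0]] := hcompl.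
have gg := gamk_graph_form hL.1 hM hLM hM0.1 hLM0.
set g := graph_form C L M M0 in gg.
have gamg := gg.1.
have MC := nijenhuis_maurer_cartan hL hM hLM hM0 hLM0 hschouten hdM hNM.
apply: (coh_class_exact hschouten (dM_linear hdM) (b0 := -1 *: g)).
  have := gamkP (-1) gg (_ : gamk C L 2 0); rewrite addr0; apply.
  by split; [exact: gam0|].
(* By bilinearity the coefficient -1/2 is absorbed into the first argument, so the sum of brackets
   has one term. *)
exists 1, (fun=> (- 2^-1) *: g), (fun=> g); split=> [_|].
  by split=> //; exact: gamZ.
rewrite big_ord1 (linear_scale (dM_linear hdM))// scaleN1r opprK.
rewrite (linear_scale (d := schouten^~ g) (fun c u v gu gv => schouten_linl hschouten c
  gu gv gamg))//.
by rewrite scaleNr; apply/eqP; rewrite -addr_eq0; apply/eqP.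
Qed.
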